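(* Let $S$ be a minimal $k$-solenoid of transversal dimension $1$, and let $T$ be a transversal of $S$. Then exactly one of the following holds: (1) $T$ is a finite union of circles, and $S$ is a compact connected $(k+1)$-dimensional manifold foliated by the $k$-dimensional leaves; (2) $T$ is totally disconnected, and either (a) $T$ is finite and $S$ is a connected compact $k$-dimensional manifold (a single leaf), or (b) $T$ is a Cantor set.
   Context: A $k$-solenoid of transversal dimension $l$ is a compact subset $S$ of a $(k+l)$-dimensional foliated manifold $W$ (charts with transitions $(x,y)\mapsto(X(x,y),Y(y))$, $x\in\mathbb{R}^k,y\in\mathbb{R}^l$) which is a union of leaves of $W$, up to the natural equivalence. A flow-box is an open $U\subset S$ with a homeomorphism $\varphi:U\to D^k\times K(U)$, $K(U)\subset\mathbb{R}^l$, restricted from a foliated chart of $W$. A local transversal at $p$ is a set $T\ni p$ with $\varphi(T)=\{0\}\times K(U)$ for some flow-box $U$ around $p$; a transversal is a compact subset $T\subset S$ such that every $p\in T$ has an open neighbourhood $V$ with $V\cap T$ a local transversal at $p$. $S$ is minimal if it contains no proper nonempty compact subset which is a union of leaves. *)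

(* Defs.v *)
(* Topological (C^0) foliations, as in the context:
   only the shape of the chart transitions is imposed. *)
From HB Require Import structures.
From mathcomp Require Import all_boot all_order all_algebra.
From mathcomp Require Import all_classical all_reals all_analysis.
Set Implicit Arguments. Unset Strict Implicit. Unset Printing Implicit Defensive.
Import Order.TTheory GRing.Theory Num.Theory.
Import numFieldNormedType.Exports.
Local Open Scope classical_set_scope.
Local Open Scope ring_scope.

Section Solenoids.
Variables (R : realType).

Definition sqnorm n (x : 'rV[R]_n) : R := \sum_(i < n) x ord0 i ^+ 2.
Definition disc n : set 'rV[R]_n := [set x | sqnorm x < 1].
Definition circle : set 'rV[R]_2 := [set x | sqnorm x = 1].

Definition homeo_on {X Y : topologicalType} (A : set X) (B : set Y)
  (f : X -> Y) : Prop :=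
  exists g : Y -> X,
    [/\ f @` A = B, (forall x, A x -> g (f x) = x),
        (forall y, B y -> f (g y) = y),
        {within A, continuous f} & {within B, continuous g}].

Variables (W : topologicalType) (k l : nat).

Record fchart := FChart { fdom : set W ; fmap : W -> 'rV[R]_k * 'rV[R]_l }.

Definition is_chart (c : fchart) : Prop :=
  [/\ open (fdom c), open (fmap c @` fdom c) &
      homeo_on (fdom c) (fmap c @` fdom c) (fmap c)].

(* the transition fmap d o (fmap c)^-1 has the form (x,y) |-> (X(x,y), Y(y)) *)
Definition fcompat (c d : fchart) : Prop :=
  exists Y : 'rV[R]_l -> 'rV[R]_l,
    forall p, fdom c p -> fdom d p -> (fmap d p).2 = Y (fmap c p).2.

Variable (I : Type) (c : I -> fchart).

Definition foliated_atlas : Prop :=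
  [/\ hausdorff_space W, (forall i, is_chart (c i)),
      (forall p, exists i, fdom (c i) p) &
      (forall i j, fcompat (c i) (c j))].

Definition compatible_chart (d : fchart) : Prop :=
  is_chart d /\ forall i, fcompat (c i) d /\ fcompat d (c i).

Definition plaque (d : fchart) (p : W) : set W :=
  connected_component (fdom d `&` [set q | (fmap d q).2 = (fmap d p).2]) p.

Inductive same_leaf (p : W) : W -> Prop :=
  | sl_refl : same_leaf p p
  | sl_step q r i : same_leaf p q -> fdom (c i) q -> plaque (c i) q r ->
      same_leaf p r.

Definition leaf (p : W) : set W := [set q | same_leaf p q].

Definition saturated (A : set W) : Prop :=
  forall p q, A p -> same_leaf p q -> A q.

Definition solenoid (S : set W) : Prop := compact S /\ saturated S.

Definition sol_minimal (S : set W) : Prop :=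
  forall A, A `<=` S -> A !=set0 -> compact A -> saturated A -> A = S.

Definition flow_box (S : set W) (d : fchart) (K : set 'rV[R]_l) : Prop :=
  compatible_chart d /\ fmap d @` (fdom d `&` S) = @disc k `*` K.

Definition local_transversal (S : set W) (p : W) (T : set W) : Prop :=
  T p /\ exists d K, [/\ flow_box S d K, fdom d p &
    T = [set q | (fdom d `&` S) q /\ (fmap d q).1 = 0]].

Definition sol_transversal (S T : set W) : Prop :=
  [/\ compact T, T `<=` S &
      forall p, T p -> exists V : set W,
        [/\ open V, V p & local_transversal S p (V `&` T)]].

End Solenoids.

Section Conclusions.
Variables (R : realType) (W : topologicalType).

Definition is_manifold (n : nat) (A : set W) : Prop :=
  forall p, A p -> exists (U : set W) (O : set 'rV[R]_n) (f : 'rV[R]_n -> W),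
    [/\ open U, U p, open O & homeo_on O (U `&` A) f].

Definition finite_union_of_circles (T : set W) : Prop :=
  exists (n : nat) (C : 'I_n -> set W),
    T = \bigcup_(i in [set: 'I_n]) C i /\
    forall i, exists f : 'rV[R]_2 -> W, homeo_on (@circle R) (C i) f.

Definition cantor_set (T : set W) : Prop :=
  exists f : cantor_space -> W, homeo_on [set: cantor_space] T f.
End Conclusions.
Arguments is_manifold R {W} n A.
Arguments finite_union_of_circles R {W} T.

(* Main.v *)
Require Import Defs.
From HB Require Import structures.
From mathcomp Require Import all_boot all_order all_algebra.
From mathcomp Require Import all_classical all_reals all_analysis.
From mathcomp Require Import lra.
Import Order.TTheory GRing.Theory Num.Theory.
Import numFieldNormedType.Exports.
(* [fmap] must denote the chart map of [Defs], not the image filter. *)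
Import Defs.
Set Implicit Arguments. Unset Strict Implicit. Unset Printing Implicit Defensive.
Local Open Scope classical_set_scope.
Local Open Scope ring_scope.

(* Interiors and closures of saturated sets are saturated, as one sees by sliding
   along the plaques of a box. Hence minimality makes S connected, and either open
   or of empty interior.

   If S is open, it is a (k+1)-manifold and T is a compact 1-manifold. Two
   overlapping lines (open embeddings of the real line) in a Hausdorff 1-manifold
   are contained in a common line, or the first one is contained in a simple
   closed curve. In a compact 1-manifold a line is never closed, so merging it with
   the members of a finite cover by lines must end with a simple closed curve, and T
   is covered by finitely many of them.

   If S has empty interior, the sections K of the flow boxes contain no interval, so
   T has small relatively clopen sets. The points near which S is a single plaque
   form a saturated, relatively open set. If T has an isolated point, this set is
   nonempty, hence all of S: then T is finite and S is one leaf. Otherwise T is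
   compact, zero-dimensional, perfect and embeds in some R^n, hence is a Cantor
   set. *)

(** * One-dimensional manifolds *)

Definition line (R : realType) (X : topologicalType) (f : R -> X) : Prop :=
  [/\ continuous f, injective f & forall O, open O -> open (f @` O)].

(** An injective open map has a continuous inverse on its image, and on [A] the map [h] is this
    inverse composed with [g]. *)
Lemma lift_continuous (X Y Z : topologicalType) (f : Y -> X) (g : Z -> X)
    (A : set Z) (h : Z -> Y) :
  injective f -> (forall O, open O -> open (f @` O)) ->
  {within A, continuous g} -> (forall z, A z -> f (h z) = g z) ->
  {within A, continuous h}.
Proof.
move=> finj fop /subspace_continuousP gC fh; apply/subspace_continuousP => z Az.
move=> N; rewrite nbhsE => -[N' [oN' N'hz] N'N].
have gN : within A (nbhs z) (g @^-1` (f @` N')).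
  apply: gC => //; apply: open_nbhs_nbhs; split; first exact: fop.
  by exists (h z) => //; exact: fh.
change (within A (nbhs z) (h @^-1` N)); move: gN; rewrite /within /=.
apply: filterS => s gs As; have [y N'y] := gs As; rewrite -fh// => /finj <-.
exact: N'N.
Qed.

Lemma line_opp (R : realType) (X : topologicalType) (f : R -> X) :
  line f -> line (f \o -%R).
Proof.
move=> [fC finj fop]; split.
- by move=> x; apply: continuous_comp; [exact: oppr_continuous|exact: fC].
- by move=> x y /finj /oppr_inj.
- move=> O oO; rewrite -image_comp; apply: fop.
  suff -> : -%R @` O = -%R @^-1` O by apply: open_comp => // x _; exact: oppr_continuous.
  by apply/seteqP; split=> [_ [x Ox <-]|x Ox] /=; rewrite ?opprK//; exists (- x); rewrite ?opprK.
Qed.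

Lemma range_opp (R : realType) (X : Type) (f : R -> X) :
  range (f \o -%R) = range f.
Proof.
by apply/seteqP; split=> [_ [x _ <-]|_ [x _ <-]]; exists (- x) => //=; rewrite opprK.
Qed.

(** If [h] stayed below [t] on [[a, b[], then [g] would send [[a, b[] into the image under [f] of
    the segment from [h a] to [t]. That image is compact, hence closed, so it would contain [g b].
    Thus [h] exceeds every [t], and the intermediate value theorem applies. *)
Lemma line_end_increasing (R : realType) (X : topologicalType) (f g : R -> X)
    (h : R -> R) (a b : R) :
  hausdorff_space X -> line f -> continuous g -> a < b ->
  ~ range f (g b) -> (forall s, a <= s < b -> f (h s) = g s) ->
  {in `[a, b[ &, {homo h : x y / x < y}} ->
  forall t, h a <= t -> exists2 s, a <= s < b & f t = g s.
Proof.
move=> hX [fC finj fop] gC ab gb fh hmono t hat.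
have hC : {within `[a, b[, continuous h}.
  by apply: (lift_continuous finj fop (continuous_subspaceT gC)) => s /=; rewrite in_itv/=; exact: fh.
have [s /andP[as_ sb] ths] : exists2 s, a <= s < b & t <= h s.
  apply: contrapT => nts; apply: gb.
  have hlt s : a <= s < b -> h s < t.
    by move=> sab; rewrite ltNge; apply/negP => tle; apply: nts; exists s.
  have cl : closed (g @^-1` (f @` `[h a, t])).
    apply: closed_comp; first by move=> *; exact: gC.
    apply: compact_closed => //; apply: continuous_compact; last exact: segment_compact.
    exact: continuous_subspaceT.
  suff [x _ <-] : (f @` `[h a, t]) (g b) by exists x.
  apply: (cl b) => N /nbhs_ballP[e /= e0 Ne].
  pose s := Num.max a (b - e / 2).
  have sab : a <= s < b by rewrite /s le_max lexx/= gt_max ab/=; lra.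
  exists s; split; last first.
    apply: Ne; rewrite /ball/= ltr_norml; move: sab => /andP[_ sb].
    have : b - e / 2 <= s by rewrite /s le_max lexx orbT.
    lra.
  exists (h s); last exact: fh.
  rewrite /= in_itv/= (ltW (hlt _ sab)) andbT.
  have /andP[+ _] := sab; rewrite [a <= _]le_eqVlt => /orP[/eqP <-//|as_].
  by apply/ltW/hmono => //; rewrite in_itv/= ?lexx ?ab// sab.
have [c cas hct] : exists2 c, c \in `[a, s] & h c = t.
  apply: IVT => //.
    apply: continuous_subspaceW hC => x /=; rewrite !in_itv/= => /andP[-> xs].
    exact: le_lt_trans sb.
  by rewrite ge_min hat/= le_max ths orbT.
exists c; last by rewrite -hct fh//; move: cas; rewrite in_itv/= => /andP[-> cs]; exact: le_lt_trans sb.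
by move: cas; rewrite in_itv/= => /andP[-> cs]; exact: le_lt_trans sb.
Qed.

(* Going right along [g] until it first leaves the image of [f], one runs
   through a whole end of [f]: by compactness and separation, [g] can only leave
   the image when the parameter on [f] tends to infinity. *)
Lemma line_end_right (R : realType) (X : topologicalType) (f g : R -> X)
    (s t z : R) :
  hausdorff_space X -> line f -> line g -> g s = f t -> s < z ->
  ~ range f (g z) -> exists2 b, s < b <= z &
  ~ range f (g b) /\
  (((forall x, s <= x < b -> exists2 y, t <= y & g x = f y) /\
    (forall y, t <= y -> exists2 x, s <= x < b & f y = g x)) \/
   ((forall x, s <= x < b -> exists2 y, y <= t & g x = f y) /\
    (forall y, y <= t -> exists2 x, s <= x < b & f y = g x))).
Proof.
move=> hX lf lg gsft sz gz; have [fC finj fop] := lf; have [gC ginj gop] := lg.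
(* The infimum [b] of [Z] is the first exit of [g] from the image of [f] after [s]. As this image is
   open, [g b] already lies outside it. *)
pose Z := [set x | s <= x /\ ~ range f (g x)].
have Zz : Z z by split=> //; exact: ltW.
have hinfZ : has_inf Z by split; [exists z|exists s => x []].
pose b := inf Z.
have sb : s <= b by apply: lb_le_inf; [exists z|move=> x []].
have bz : b <= z by apply: ge_inf => //; case: hinfZ.
have oU : open (g @^-1` range f).
  by apply: open_comp; [move=> *; exact: gC|exact/fop/openT].
have gb : ~ range f (g b).
  move=> Ub; have : nbhs b (g @^-1` range f) by apply: open_nbhs_nbhs.
  move=> /nbhs_ballP[e /= e0 be].
  have [x Zx xb] := inf_adherent e0 hinfZ.
  have bx : b <= x by apply: ge_inf => //; case: hinfZ.
  case: Zx => _; apply; apply: be; rewrite /ball/= ltr_norml; move: xb bx; rewrite -/b; lra.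
have {}sb : s < b.
  by rewrite lt_neqAle sb andbT; apply/eqP => sb'; apply: gb; rewrite -sb' gsft; exists t.
have inU x : s <= x < b -> range f (g x).
  move=> /andP[sx xb]; apply: contrapT => nU.
  by move: xb; rewrite ltNge => /negP; apply; apply: ge_inf; [case: hinfZ|].
exists b; first by rewrite sb.
split=> //.
pose h x := xget 0 [set y | f y = g x].
have fh x : s <= x < b -> f (h x) = g x.
  by move=> /inU[y _ fy]; rewrite /h; case: xgetP => [w -> //|/(_ y)/(_ fy)].
have hst : h s = t by apply: finj; rewrite fh// lexx sb.
have hC : {within `[s, b[, continuous h}.
  by apply: (lift_continuous finj fop (continuous_subspaceT gC)) => x /=; rewrite in_itv/=; exact: fh.
have hinj : {in `[s, b[ &, injective h}.
  by move=> x y; rewrite !in_itv/= => xi yi hxy; apply: ginj; rewrite -fh// hxy fh.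
have sin : s \in `[s, b[ by rewrite in_itv/= lexx.
(* [h] reads [g] in the parameter of [f]. Being injective and continuous it is monotone: increasing,
   it runs to the right end of [f]; decreasing, to the left end. *)
have [hmono|hmono] := itv_continuous_inj_mono hC hinj; [left|right]; split.
- move=> x xi; exists (h x); last by rewrite fh.
  rewrite -hst; move: (xi) => /andP[+ _]; rewrite [s <= _]le_eqVlt => /orP[/eqP ->//|sx].
  by apply/ltW/hmono; rewrite ?in_itv.
- by rewrite -hst; exact: (line_end_increasing hX lf gC sb gb fh).
- move=> x xi; exists (h x); last by rewrite fh.
  rewrite -hst; move: (xi) => /andP[+ _]; rewrite [s <= _]le_eqVlt => /orP[/eqP ->//|sx].
  by apply/ltW/hmono; rewrite ?in_itv.
- move=> y yt.
  (* A decreasing [h] becomes increasing once [f] is reversed. *)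
  have [||//||x xi fgx] := @line_end_increasing _ _ (f \o -%R) g (fun x => - h x) s b hX (line_opp lf) gC sb _ _ _ (- y).
  + by rewrite range_opp.
  + by move=> x xi; rewrite /= opprK fh.
  + by move=> x x' xi xi' xx'; rewrite ltrN2; exact: hmono.
  + by rewrite hst lerN2.
  + by exists x => //; rewrite -fgx /= opprK.
Qed.

Lemma line_end_left (R : realType) (X : topologicalType) (f g : R -> X)
    (s t z : R) :
  hausdorff_space X -> line f -> line g -> g s = f t -> z < s ->
  ~ range f (g z) -> exists2 b, z <= b < s &
  ~ range f (g b) /\
  (((forall x, b < x <= s -> exists2 y, t <= y & g x = f y) /\
    (forall y, t <= y -> exists2 x, b < x <= s & f y = g x)) \/
   ((forall x, b < x <= s -> exists2 y, y <= t & g x = f y) /\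
    (forall y, y <= t -> exists2 x, b < x <= s & f y = g x))).
Proof.
move=> hX lf lg gsft zs gz.
have [|||b /andP[sb bz] [gb E]] :=
  @line_end_right _ _ f (g \o -%R) (- s) t (- z) hX lf (line_opp lg).
- by rewrite /= opprK.
- by rewrite ltrN2.
- by rewrite /= opprK.
exists (- b); first by rewrite lerNr bz ltrNl sb.
split=> //.
case: E => -[E1 E2]; [left|right]; split.
- move=> x /andP[bx xs]; have [|y ty] := E1 (- x); last by rewrite /= opprK; exists y.
  by rewrite lerN2 xs ltrNl.
- move=> y /E2[x /andP[sx xb] fx]; exists (- x) => //.
  by rewrite ltrN2 xb lerNl.
- move=> x /andP[bx xs]; have [|y ty] := E1 (- x); last by rewrite /= opprK; exists y.
  by rewrite lerN2 xs ltrNl.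
- move=> y /E2[x /andP[sx xb] fx]; exists (- x) => //.
  by rewrite ltrN2 xb lerNl.
Qed.

(** Invariance of domain in dimension one. Read in a line around [g x], the map [g] is strictly
    monotone on a segment around [x], so by the intermediate value theorem its image contains an
    interval around the parameter of [g x]. *)
Lemma injective_continuous_open (R : realType) (X : topologicalType) (g : R -> X) :
  (forall p : X, exists2 f : R -> X, line f & range f p) ->
  continuous g -> injective g -> forall O, open O -> open (g @` O).
Proof.
move=> mX gC ginj O oO; rewrite openE => _ [x Ox <-].
have [f [fC finj fop] [y _ fy]] := mX (g x).
have : nbhs x (O `&` g @^-1` range f).
  apply: filterI; first exact: open_nbhs_nbhs.
  by apply: gC; apply: open_nbhs_nbhs; split; [exact/fop/openT|exists y].
move=> /nbhs_ballP[e /= e0 xe].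
pose a := x - e / 2; pose b := x + e / 2.
have eab z : a <= z <= b -> O z /\ range f (g z).
  by move=> zab; apply: xe; rewrite /ball/= ltr_norml; move: zab; rewrite /a /b; lra.
pose h z := xget 0 [set y | f y = g z].
have fh z : a <= z <= b -> f (h z) = g z.
  by move=> /eab[_ [w _ fw]]; rewrite /h; case: xgetP => [v -> //|/(_ w)/(_ fw)].
have hC : {within `[a, b], continuous h}.
  by apply: (lift_continuous finj fop (continuous_subspaceT gC)) => z /=; rewrite in_itv/=; exact: fh.
have hinj : {in `[a, b] &, injective h}.
  by move=> z w; rewrite !in_itv/= => zi wi hzw; apply: ginj; rewrite -fh// hzw fh.
pose m := Num.min (h a) (h b); pose M := Num.max (h a) (h b).
have ai : a \in `[a, b] by rewrite in_itv/= /a /b; lra.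
have bi : b \in `[a, b] by rewrite in_itv/= /a /b; lra.
have xi : x \in `[a, b] by rewrite in_itv/= /a /b; lra.
have ax : a < x by rewrite /a; lra.
have xb : x < b by rewrite /b; lra.
have ab : a <= b by rewrite /a /b; lra.
have hx : m < h x < M.
  have [hm|hm] := itv_continuous_inj_mono hC hinj.
    by rewrite /m /M gt_min lt_max (hm a x)// (hm x b)// orbT.
  by rewrite /m /M gt_min lt_max (hm x a)// (hm b x)// orbT.
have : nbhs (g x) (f @` `]m, M[).
  apply: open_nbhs_nbhs; split; first exact/fop/interval_open.
  by exists (h x); [rewrite /= in_itv|apply: fh; move: xi; rewrite in_itv].
apply: filterS => _ [v /= + <-]; rewrite in_itv/= => /andP[mv vM].
have [|z zab hz] := @IVT _ h a b v ab hC; first by rewrite (ltW mv) (ltW vM).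
move: zab; rewrite in_itv/= => zab; exists z; first by have [] := eab z zab.
by rewrite -fh// hz.
Qed.

Definition glue (R : realType) (X : Type) (f g : R -> X) (s t x : R) : X :=
  if x <= t then f x else g (s + (x - t)).

Lemma glue_left (R : realType) (X : Type) (f g : R -> X) (s t x : R) :
  x <= t -> glue f g s t x = f x.
Proof. by rewrite /glue => ->. Qed.

Lemma glue_right (R : realType) (X : Type) (f g : R -> X) (s t x : R) :
  g s = f t -> t <= x -> glue f g s t x = g (s + (x - t)).
Proof.
rewrite /glue => gsft tx; case: ifPn => // xt.
have -> : x = t by apply/le_anti; rewrite xt.
by rewrite subrr addr0 gsft.
Qed.

Lemma glue_continuous (R : realType) (X : topologicalType) (f g : R -> X)
    (s t : R) :
  continuous f -> continuous g -> g s = f t -> continuous (glue f g s t).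
Proof.
move=> fC gC gsft; apply/continuous_subspace_setT.
have -> : [set: R] = `]-oo, t] `|` `[t, +oo[.
  by apply/seteqP; split=> // x _; rewrite /= !in_itv/= andbT; apply/orP/le_total.
apply: withinU_continuous.
- exact: interval_closed.
- exact: interval_closed.
- apply: (@subspace_eq_continuous _ _ _ f); last exact: continuous_subspaceT.
  by move=> x; rewrite inE/= in_itv/= => xt; exact/esym/glue_left.
- apply: (@subspace_eq_continuous _ _ _ (fun x => g (s + (x - t)))); last first.
    apply: continuous_subspaceT => x.
    apply: continuous_comp; last exact: gC.
    by apply: cvgD; [exact: cvg_cst|apply: cvgB; [exact: cvg_id|exact: cvg_cst]].
  by move=> x; rewrite inE/= in_itv/= andbT => tx; exact/esym/glue_right.
Qed.

(** The curve is defined and continuous on the whole real line, but only its values on [[a, b]]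
    matter. *)
Definition simple_loop (R : realType) (X : topologicalType) (k : R -> X)
    (a b : R) : Prop :=
  [/\ continuous k, a < b, k a = k b &
      forall x y, a <= x < b -> a <= y < b -> k x = k y -> x = y].

(** The two cases are not symmetric: a loop only has to contain [f], the line that is being
    enlarged. *)
Definition merge_lines (R : realType) (X : topologicalType) (f g : R -> X) :=
  (exists k : R -> X, [/\ line k, range f `<=` range k & range g `<=` range k]) \/
  (exists (k : R -> X) (a b : R), simple_loop k a b /\ range f `<=` k @` `[a, b]).

(** The case where [g] goes out through the right end of [f]. By injectivity [g] cannot run through
    the same end of [f] twice, so what happens before [s] and after [b] leaves three pictures: [g]
    covers [f], the two lines form a longer line, or they close up to a loop. *)
Lemma merge_lines_end (R : realType) (X : topologicalType) (f g : R -> X)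
    (s t b : R) :
  hausdorff_space X ->
  (forall p : X, exists2 f : R -> X, line f & range f p) ->
  line f -> line g -> g s = f t -> s < b -> ~ range f (g b) ->
  (forall x, s <= x < b -> exists2 y, t <= y & g x = f y) ->
  (forall y, t <= y -> exists2 x, s <= x < b & f y = g x) ->
  merge_lines f g.
Proof.
move=> hX mX lf lg gsft sb gb gf fg.
have [fC finj fop] := lf; have [gC ginj gop] := lg.
(* If [g] also leaves the image of [f] before [s], it does so through the left end, and then [g]
   contains all of [f]. *)
have [[z zs gz]|Bl] := pselect (exists2 z, z < s & ~ range f (g z)).
  have [b' /andP[zb' b's] [gb' [[gf' fg']|[gf' fg']]]] :=
    line_end_left hX lf lg gsft zs gz.
    have t1 : t <= t + 1 by rewrite lerDl.
    have [x /andP[sx xb] fx] := fg _ t1; have [x' /andP[bx' xs'] fx'] := fg' _ t1.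
    have xx' : x = x' by apply: ginj; rewrite -fx.
    have xs : x = s by apply/le_anti; rewrite sx xx' xs'.
    move: fx; rewrite xs gsft => /finj; lra.
  left; exists g; split=> // _ [y _ <-].
  have [/fg[x _ ->]|/ltW/fg'[x _ ->]] := leP t y; by exists x.
have {}Bl x : x <= s -> range f (g x).
  rewrite le_eqVlt => /orP[/eqP ->|xs]; first by rewrite gsft; exists t.
  by apply: contrapT => ngx; apply: Bl; exists x.
have kC := glue_continuous fC gC gsft.
have kl x : x <= t -> glue f g s t x = f x by exact: glue_left.
have kr x : t <= x -> glue f g s t x = g (s + (x - t)) by exact: glue_right.
(* If [g] never comes back to [f] after [b], following [f] up to [t] and then [g] from [s] on is
   injective. It contains [g] because the part of [g] before [s] lies in [f]. *)
have [[s2 bs2 gs2]|Br] := pselect (exists2 z, b < z & range f (g z)); last first.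
  have {}Br x : b <= x -> ~ range f (g x).
    rewrite le_eqVlt => /orP[/eqP <-//|bx] gx; by apply: Br; exists x.
  left; exists (glue f g s t).
  have kinj : injective (glue f g s t).
    move=> x y; wlog xy : x y / x <= y.
      by move=> W; have [/W//|/ltW/W + /esym E] := leP x y => /(_ E).
    have [yt|ty] := leP y t.
      by rewrite !kl// ?(le_trans xy)// => /finj.
    have [xt|tx] := leP x t; last first.
      rewrite !kr ?ltW// => /ginj; lra.
    rewrite kl// kr ?ltW// => fx; exfalso.
    have [yb|by_] := ltP (s + (y - t)) b; last first.
      by apply: (Br _ by_); rewrite -fx; exists x.
    have [|w tw] := gf (s + (y - t)); first by rewrite yb; lra.
    rewrite -fx => /finj xw.
    have {}xt : x = t by apply/le_anti; rewrite xt xw.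
    by move: fx; rewrite xt -gsft => /ginj; lra.
  have gk x : s <= x -> range (glue f g s t) (g x).
    by move=> sx; exists (t + (x - s)) => //; rewrite kr; [congr g|]; lra.
  have fk : range f `<=` range (glue f g s t).
    move=> _ [y _ <-]; have [/fg[x /andP[sx _] ->]|/ltW yt] := leP t y; first exact: gk.
    by exists y => //; rewrite kl.
  split=> //; first by split=> //; exact: injective_continuous_open.
  move=> _ [x _ <-]; have [/gk//|/ltW/Bl gx] := leP s x.
  exact: fk.
have [t2 _ ft2] := gs2.
(* Going backwards from the return at [s2], [g] leaves [f] through one of its ends. The right end is
   already used on [[s, b[], so it is the left one. *)
have [b' /andP[bb' b's2] [gb' [[gf' fg']|[gf' fg']]]] :=
    line_end_left hX lf lg (esym ft2) bs2 gb.
  exfalso; pose y := Num.max t t2.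
  have [x /andP[_ xb] fx] : exists2 x, s <= x < b & f y = g x.
    by apply: fg; rewrite le_max lexx.
  have [x' /andP[bx _] fx'] : exists2 x, b' < x <= s2 & f y = g x.
    by apply: fg'; rewrite le_max lexx orbT.
  have : x = x' by apply: ginj; rewrite -fx.
  lra.
have t2t : t2 < t.
  rewrite ltNge; apply/negP => /fg[x xi fx]; have : x = s2 by apply: ginj; rewrite -fx ft2.
  lra.
(* A further visit to [f] between [b] and [b'] would run through an end of [f] a second time. *)
have gmid x : b <= x <= b' -> ~ range f (g x).
  move=> /andP[bx xb']; move: (xb'); rewrite le_eqVlt => /orP[/eqP -> //|{}xb'] [t3 _ ft3].
  have [c /andP[xc cb'] [gc [[_ fg3]|[_ fg3]]]] :=
    line_end_right hX lf lg (esym ft3) xb' gb'.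
    have [x1 x1i fx1] : exists2 x, s <= x < b & f (Num.max t t3) = g x.
      by apply: fg; rewrite le_max lexx.
    have [x2 x2i fx2] : exists2 y, x <= y < c & f (Num.max t t3) = g y.
      by apply: fg3; rewrite le_max lexx orbT.
    have : x1 = x2 by apply: ginj; rewrite -fx1.
    lra.
  have [x1 x1i fx1] : exists2 x, b' < x <= s2 & f (Num.min t2 t3) = g x.
    by apply: fg'; rewrite ge_min lexx.
  have [x2 x2i fx2] : exists2 y, x <= y < c & f (Num.min t2 t3) = g y.
    by apply: fg3; rewrite ge_min lexx orbT.
  have : x1 = x2 by apply: ginj; rewrite -fx1.
  lra.
(* The loop follows [f] from [t2] to [t], then [g] from [s] to [s2], where [g s2 = f t2]. It is
   simple because between [s] and [s2] the curve [g] is first on [f] beyond [t], then off [f], then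
   on [f] before [t2]. *)
right; exists (glue f g s t), t2, (t + (s2 - s)).
have ss2 : s < s2 by lra.
split.
  split=> //.
  - lra.
  - rewrite kl ?ltW// kr; last lra.
    by rewrite ft2; congr g; lra.
  move=> x y; wlog xy : x y / x <= y.
    by move=> W xi yi; have [/W|/ltW/W + /esym E] := leP x y; [exact|move/(_ yi xi E)].
  move=> /andP[t2x _] /andP[_ ys2].
  have [yt|ty] := leP y t.
    by rewrite !kl// ?(le_trans xy)// => /finj.
  have [xt|tx] := leP x t; last first.
    by rewrite !kr ?ltW// => /ginj; lra.
  rewrite kl// kr ?ltW// => fx; exfalso.
  have [yb|by_] := ltP (s + (y - t)) b.
    have [|w tw] := gf (s + (y - t)); first by rewrite yb; lra.
    rewrite -fx => /finj xw.
    have {}xt : x = t by apply/le_anti; rewrite xt xw.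
    by move: fx; rewrite xt -gsft => /ginj; lra.
  have [yb'|b'y] := leP (s + (y - t)) b'.
    by apply: (@gmid (s + (y - t))); [rewrite by_|rewrite -fx; exists x].
  have [|w wt2] := gf' (s + (y - t)); first by rewrite b'y; lra.
  rewrite -fx => /finj xw.
  have {}xt : x = t2 by apply/le_anti; rewrite xw wt2 -xw.
  by move: fx; rewrite xt ft2 => /ginj; lra.
have gk x : s <= x <= s2 -> (glue f g s t @` `[t2, t + (s2 - s)]) (g x).
  move=> xi; exists (t + (x - s)); first by rewrite /= in_itv/=; lra.
  by rewrite kr; [congr g|]; lra.
move=> _ [y _ <-]; have [/fg[x xi ->]|yt] := leP t y; first by apply: gk; lra.
have [/fg'[x xi ->]|t2y] := leP y t2; first by apply: gk; lra.
by exists y; [rewrite /= in_itv/=; lra|rewrite kl// ltW].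
Qed.

Lemma merge_lines_intersect (R : realType) (X : topologicalType) (f g : R -> X) :
  hausdorff_space X ->
  (forall p : X, exists2 f : R -> X, line f & range f p) ->
  line f -> line g -> range f `&` range g !=set0 -> merge_lines f g.
Proof.
move=> hX mX lf lg [_ [[t _ <-] [s _ gsft]]].
have [gf|ngf] := pselect (range g `<=` range f); first by left; exists f; split.
move: ngf => /existsNP[_ /not_implyP[[z _ <-] gz]].
(* Reversing [g] if necessary, it leaves the image of [f] after [s]. *)
wlog sz : g lg s z gsft gz / s < z.
  move=> W; have [sz|zs|sz] := ltgtP s z; first exact: (W g lg s z gsft gz sz).
    rewrite /merge_lines -(range_opp g); apply: (W _ (line_opp lg) (- s) (- z)) => //=.
    - by rewrite opprK.
    - by rewrite opprK.
    - by rewrite ltrN2.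
  by exfalso; apply: gz; rewrite -sz gsft; exists t.
have [b /andP[sb _] [gb [[gf fg]|[gf fg]]]] := line_end_right hX lf lg gsft sz gz.
  exact: (merge_lines_end hX mX lf lg gsft sb gb gf fg).
(* Here [g] goes out through the left end of [f], which is the right end of the reversed line. *)
rewrite /merge_lines -(range_opp f).
apply: (@merge_lines_end _ _ _ g s (- t) b hX mX (line_opp lf) lg) => //.
- by rewrite /= opprK.
- by rewrite range_opp.
- by move=> x /gf[y yt ->]; exists (- y); rewrite ?lerN2 /= ?opprK.
- by move=> y ty; apply: fg; rewrite lerNl.
Qed.

(** If no finite subfamily covered [A], the sets of points missed by finite subfamilies would
    generate a proper filter on [A]. A cluster point of it lies in some [f i], which contradicts the
    set of points missed by [f i]. *)
Lemma compact_finite_cover (X : topologicalType) (A : set X) (I : eqType)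
    (D : set I) (f : I -> set X) :
  compact A -> (forall i, D i -> open (f i)) -> A `<=` \bigcup_(i in D) f i ->
  exists s : seq I, (forall i, i \in s -> D i) /\
    forall x, A x -> exists2 i, i \in s & f i x.
Proof.
move=> cA fop Af; apply: contrapT => nocover.
pose B (s : seq I) := [set x | A x /\ forall i, i \in s -> ~ f i x].
pose F := filter_from [set s : seq I | forall i, i \in s -> D i] B.
have FF : ProperFilter F.
  apply: filter_from_proper; first apply: filter_from_filter.
  - by exists [::].
  - move=> s1 s2 D1 D2; exists (s1 ++ s2).
      by move=> i; rewrite mem_cat => /orP[/D1|/D2].
    by move=> x [Ax nx]; split; split=> // i si; apply: nx; rewrite mem_cat si ?orbT.
  move=> s Ds; apply: contrapT => sn; apply: nocover; exists s; split=> // x Ax.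
  apply: contrapT => nx; apply: sn; exists x; split=> // i si fx.
  by apply: nx; exists i.
have FA : F A by exists [::] => // x [].
have [x [Ax clx]] := cA F FF FA.
have [i Di fix_] := Af _ Ax.
have [||y [[_ ny] fy]] := clx (B [:: i]) (f i).
- by exists [:: i] => // j /[!inE]/eqP ->.
- by apply: open_nbhs_nbhs; split=> //; exact: fop.
- by apply: (ny i) => //; rewrite inE.
Qed.

Lemma rV_continuous (R : realType) (X : topologicalType) (n : nat)
    (f : X -> 'rV[R]_n) (u : 'I_n -> X -> R) (x : X) :
  (forall z j, f z ord0 j = u j z) -> (forall j, {for x, continuous (u j)}) ->
  {for x, continuous f}.
Proof.
move=> fu uC B [P MP PB].
have : nbhs x [set z | forall j, P ord0 j (f z ord0 j)].
  apply: filter_forall => j; have : nbhs x (u j @^-1` P ord0 j).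
    by apply: (uC j); rewrite -fu; exact: MP.
  by apply: filterS => z; rewrite /preimage/= fu.
by apply: filterS => z Pz; apply: PB => i j; rewrite ord1.
Qed.

(** * The circle as a segment with its endpoints identified *)

Definition circ (R : realType) (t : R) : 'rV[R]_2 :=
  \row_(j < 2) if j == ord0 then cos t else sin t.

Lemma circ_continuous (R : realType) : continuous (@circ R).
Proof.
move=> t; apply: (@rV_continuous _ _ _ _ (fun j => if j == ord0 then cos else sin)).
  by move=> z j; rewrite mxE; case: ifP.
by move=> j; case: ifP => _; [exact: continuous_cos|exact: continuous_sin].
Qed.

Lemma circ_eqP (R : realType) (s t : R) :
  circ s = circ t <-> cos s = cos t /\ sin s = sin t.
Proof.
split=> [E|[E1 E2]]; last by apply/rowP => j; rewrite !mxE E1 E2.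
by split; [have := congr1 (fun v : 'rV_2 => v ord0 ord0) E|have := congr1 (fun v : 'rV_2 => v ord0 (lift ord0 ord0)) E]; rewrite !mxE.
Qed.

Lemma circ_inj (R : realType) (s t : R) :
  0 <= s < pi *+ 2 -> 0 <= t < pi *+ 2 -> circ s = circ t -> s = t.
Proof.
wlog st : s t / s <= t.
  by move=> W si ti E; have [st|/ltW ts] := leP s t; [exact: W|exact/esym/W].
move=> si ti /circ_eqP[cst sst].
(* With half the difference of the angles, [cos (t - s) = 1] becomes [sin u = 0], where
   [0 <= u < pi]; hence [u = 0]. *)
pose u := (t - s) / 2.
have u2 : t - s = u *+ 2 by rewrite /u mulr2n; lra.
have : cos (t - s) = 1 by rewrite cosB cst sst -!expr2 cos2Dsin2.
rewrite u2 cos_mulr2n => cu; have su : sin u ^+ 2 = 0 by have := cos2Dsin2 u; move: cu; rewrite mulr2n; lra.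
have {}su : sin u = 0 by apply/eqP; rewrite -sqrf_eq0 su.
have [u0|u0] := ltP 0 u; last by move: u2; rewrite mulr2n; lra.
have : 0 < sin u.
  by apply: sin_gt0_pi; rewrite u0/= /u; move: si ti; rewrite mulr2n; lra.
by rewrite su ltxx.
Qed.

Lemma circ_image (R : realType) : @circ R @` `[0, pi *+ 2] = @circle R.
Proof.
apply/seteqP; split=> [_ [t _ <-]|v]; rewrite /circle /= /sqnorm !big_ord_recl big_ord0 addr0.
  by rewrite !mxE/= cos2Dsin2.
set x := v ord0 ord0; set y := v ord0 _ => xy.
have xi : -1 <= x <= 1.
  by rewrite -ler_norml -(@ler_pXn2r _ 2)// ?nnegrE// expr1n real_normK ?num_real//; have := sqr_ge0 y; lra.
have p0 := pi_ge0 R.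
have a0 := acos_ge0 xi; have ap := acos_lepi xi.
have sa : sin (acos x) = `|y|.
  by rewrite sin_acos// -xy addrAC subrr add0r sqrtr_sqr.
have vE t : cos t = x -> sin t = y -> circ t = v.
  move=> ct st; apply/rowP => j; rewrite mxE ct st.
  case: j => -[|[|//]] lj /=; rewrite /x /y; congr (v _ _); exact: val_inj.
have [y0|y0] := leP 0 y.
  exists (acos x); first by rewrite /= in_itv/= a0 mulr2n; lra.
  by apply: vE; [rewrite acosK|rewrite sa ger0_norm].
exists (- acos x + pi *+ 2); first by rewrite /= in_itv/= mulr2n; lra.
apply: vE; first by rewrite cosD2pi cosN acosK.
by rewrite sinD2pi sinN sa ltr0_norm// opprK.
Qed.

(** On the compact set [K] the map [e] is closed onto its image, hence a quotient map: the preimage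
    under [f] of a closed [F] is the image under [e] of the compact set of those [z] in [K] with
    [k z] in [F]. *)
Lemma factor_continuous (X Y Z : topologicalType) (K : set Z) (e : Z -> X)
    (k : Z -> Y) (f : X -> Y) :
  hausdorff_space X -> compact K -> continuous e -> continuous k ->
  (forall z, K z -> f (e z) = k z) -> {within e @` K, continuous f}.
Proof.
move=> hX cK eC kC fe; apply/continuous_closedP => F cF.
apply/closed_subspaceP; exists (e @` (K `&` k @^-1` F)).
  apply: compact_closed => //; apply: continuous_compact.
    exact: continuous_subspaceT.
  by apply: compact_closedI => //; apply: closed_comp => // *; exact: kC.
apply/seteqP; split=> [_ [[z [Kz Fz] <-] _]|x [Fz [z Kz ez]]].
  by split; [have := Fz; rewrite /preimage/= -fe|exists z].
by split; [exists z => //; split=> //=; rewrite -fe// ez|exists z].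
Qed.

(** Both images are the quotient of [K] by the same equivalence relation. *)
Lemma same_fibers_homeo (X Y Z : topologicalType) (K : set Z) (e : Z -> X)
    (k : Z -> Y) :
  hausdorff_space X -> hausdorff_space Y -> compact K -> K !=set0 ->
  continuous e -> continuous k ->
  (forall z w, K z -> K w -> e z = e w <-> k z = k w) ->
  exists f : X -> Y, homeo_on (e @` K) (k @` K) f.
Proof.
move=> hX hY cK [z0 Kz0] eC kC ek.
(* [xget] picks some preimage in [K]. Its choice is harmless since the fibers agree, and the default
   [z0] serves only off the image. *)
pose f x := k (xget z0 [set z | K z /\ e z = x]).
pose g y := e (xget z0 [set z | K z /\ k z = y]).
have fe z : K z -> f (e z) = k z.
  move=> Kz; rewrite /f; case: xgetP => [w -> [Kw ew]|/(_ z)/(_ (conj Kz erefl))//].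
  exact/ek.
have gk z : K z -> g (k z) = e z.
  move=> Kz; rewrite /g; case: xgetP => [w -> [Kw ew]|/(_ z)/(_ (conj Kz erefl))//].
  exact/ek.
exists f, g; split.
- apply/seteqP; split=> [_ [_ [z Kz <-] <-]|_ [z Kz <-]].
    by exists z => //; rewrite fe.
  by exists (e z); [exists z|rewrite fe].
- by move=> _ [z Kz <-]; rewrite fe// gk.
- by move=> _ [z Kz <-]; rewrite gk// fe.
- exact: (factor_continuous hX cK eC kC fe).
- exact: (factor_continuous hY cK kC eC gk).
Qed.

(** After an affine change of parameter from [[0, pi *+ 2]] to [[a, b]], both [circ] and [k]
    identify the two endpoints and nothing else. *)
Lemma simple_loop_circle (R : realType) (X : topologicalType) (k : R -> X)
    (a b : R) :
  hausdorff_space X -> simple_loop k a b ->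
  exists f : 'rV[R]_2 -> X, homeo_on (@circle R) (k @` `[a, b]) f.
Proof.
move=> hX [kC ab kab kinj].
have p0 : 0 < pi *+ 2 :> R by rewrite mulr2n addr_gt0// pi_gt0.
pose c := (b - a) / (pi *+ 2).
have c0 : 0 < c by rewrite divr_gt0// subr_gt0.
have cp : c * pi *+ 2 = b - a by rewrite -mulrnAr /c divfK// gt_eqF.
pose r (t : R) := a + c * t.
have rC : continuous r.
  by move=> t; apply: cvgD; [exact: cvg_cst|exact: mulrl_continuous].
have -> : k @` `[a, b] = (k \o r) @` `[0, pi *+ 2].
  apply/seteqP; split=> [_ [x /= + <-]|_ [t /= + <-]]; rewrite in_itv/= => xi.
    exists ((x - a) / c); last by rewrite /= /r mulrC divfK ?gt_eqF// addrC subrK.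
    have /andP[ax xb] := xi.
    rewrite /= in_itv/= divr_ge0 ?subr_ge0 ?ax ?(ltW c0)//=.
    by rewrite ler_pdivrMr// mulrC mulrnAr cp lerB.
  have /andP[t0 t2] := xi.
  exists (r t) => //; rewrite /= in_itv/= /r lerDl mulr_ge0 ?(ltW c0)//=.
  have : c * t <= c * (pi *+ 2) by rewrite ler_pM2l.
  by rewrite mulrnAr cp; lra.
rewrite -circ_image; apply: (@same_fibers_homeo 'rV[R]_2 X R) => //.
- exact: segment_compact.
- by exists 0; rewrite /= in_itv/= lexx ltW.
- exact: circ_continuous.
- by move=> t; apply: continuous_comp; [exact: rC|exact: kC].
have r0 : r 0 = a by rewrite /r mulr0 addr0.
have r2 : r (pi *+ 2) = b by rewrite /r mulrnAr cp addrC subrK.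
have ci0 : circ (pi *+ 2) = circ 0 :> 'rV[R]_2.
  by apply/circ_eqP; rewrite cos2pi sin2pi cos0 sin0.
have red t : t \in `[0, pi *+ 2] -> exists2 u : R, 0 <= u < pi *+ 2 &
    circ t = circ u /\ k (r t) = k (r u).
  rewrite in_itv/= => /andP[t0]; rewrite le_eqVlt => /orP[/eqP->|t2].
    by exists 0; rewrite ?lexx// ci0 r0 r2 kab.
  by exists t => //; rewrite t0.
move=> s t /= /red[u ui [-> ->]] /red[v vi [-> ->]].
have ri w : 0 <= w < pi *+ 2 -> a <= r w < b.
  move=> /andP[w0 w2]; rewrite /r lerDl mulr_ge0 ?(ltW c0)//=.
  have : c * w < c * (pi *+ 2) by rewrite ltr_pM2l.
  by rewrite mulrnAr cp; lra.
split=> [/circ_inj->//|/kinj E].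
have : r u = r v by apply: E; exact: ri.
by rewrite /r => /addrI /(mulfI (lt0r_neq0 c0)) ->.
Qed.

Lemma count_lt (T : eqType) (p q : pred T) (s : seq T) (x : T) :
  subpred p q -> x \in s -> q x -> ~~ p x -> (count p s < count q s)%N.
Proof.
move=> pq + qx px; elim: s => //= y s IH; rewrite in_cons => /orP[/eqP <-|/IH lt].
  by rewrite qx (negbTE px) add0n add1n ltnS sub_count.
rewrite -addnS leq_add//; case py: (p y) => //.
by rewrite pq.
Qed.

(** The images of the intervals []-n, n[] form an open cover. A finite subfamily with largest index
    [m] misses [f m]. *)
Lemma line_not_compact (R : realType) (X : topologicalType) (f : R -> X) :
  line f -> ~ compact (range f).
Proof.
move=> [fC finj fop] cf.
have [||s [_ scov]] := @compact_finite_cover _ _ nat setT (fun n => f @` `](- n%:R), n%:R[) cf.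
- by move=> n _; apply/fop/interval_open.
- move=> _ [x _ <-]; exists (Num.truncn `|x|).+1 => //; exists x => //.
  by rewrite /= in_itv/= -ltr_norml truncnS_gt.
- pose m := foldr maxn 0%N s.
  have sm n : n \in s -> (n <= m)%N.
    rewrite /m; elim: s {scov m} => //= a s IH; rewrite in_cons => /orP[/eqP ->|/IH]; first exact: leq_maxl.
    by move=> /leq_trans; apply; exact: leq_maxr.
  have [|n /sm nm [y + /finj ym]] := scov (f m%:R); first by exists m%:R.
  by rewrite /= in_itv/= ym ltr_nat ltnNge nm andbF.
Qed.

(* A line that no simple loop contains is not closed, hence can be merged with
   a line of a fixed finite cover that it does not yet contain. *)
Lemma line_sub_loop (R : realType) (X : topologicalType) (f : R -> X) :
  hausdorff_space X -> compact [set: X] ->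
  (forall p : X, exists2 f : R -> X, line f & range f p) -> line f ->
  exists (k : R -> X) (a b : R), simple_loop k a b /\ range f `<=` k @` `[a, b].
Proof.
move=> hX cX mX.
have /choice[L Ll] : forall p : X, exists f : R -> X, line f /\ range f p.
  by move=> p; have [g lg gp] := mX p; exists g.
have [||s [_ scov]] := @compact_finite_cover _ _ X setT (fun p => range (L p)) cX.
- by move=> p _; have [[_ _ Lop] _] := Ll p; exact/Lop/openT.
- by move=> p _; exists p => //; have [] := Ll p.
(* The induction is on the number of lines of the cover not contained in the current line; merging
   with such a line lowers it. *)
pose miss (g : R -> X) := count (fun p => ~~ `[< range (L p) `<=` range g >]) s.
have [n] := ubnP (miss f); elim: n f => // n IH f; rewrite ltnS => fn lf.
have [[p ps [pf npf]]|nop] := pselect (exists2 p, p \in s &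
    range f `&` range (L p) !=set0 /\ ~ range (L p) `<=` range f).
  have [lLp _] := Ll p.
  have [[k [lk fk Lk]]|//] := merge_lines_intersect hX mX lf lLp pf.
  have [|//|k' [a [b [lk' kk']]]] := IH k.
    apply: leq_trans fn; apply: (@count_lt _ _ _ _ p) => //.
    - by move=> q; apply: contra => /asboolP qf; apply/asboolP; exact: subset_trans fk.
    - exact/asboolPn.
    - by rewrite negbK; exact/asboolP.
  by exists k', a, b; split=> //; exact: subset_trans kk'.
(* Now every line of the cover that meets [f] lies inside [f]. So the complement of the image of [f]
   is open and the image is compact. *)
exfalso; apply: (line_not_compact lf).
rewrite -[range f]setTI; apply: compact_closedI => //.
rewrite -[range f]setCK; apply: open_closedC; rewrite openE => x nfx.
have [p ps Lpx] := scov x I.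
have [[_ _ Lop] _] := Ll p.
have : nbhs x (range (L p)) by apply: open_nbhs_nbhs; split=> //; exact/Lop/openT.
apply: filterS => y Lpy fy; apply: nop; exists p => //; split; first by exists y.
by move=> /(_ _ Lpx).
Qed.

(** Each line of a finite cover is enlarged to a loop separately; the loops may overlap or
    coincide. *)
Lemma compact_one_manifold_loops (R : realType) (X : topologicalType) :
  hausdorff_space X -> compact [set: X] ->
  (forall p : X, exists2 f : R -> X, line f & range f p) ->
  exists (n : nat) (k : 'I_n -> R -> X) (a b : 'I_n -> R),
    (forall i, simple_loop (k i) (a i) (b i)) /\
    forall p, exists i, (k i @` `[a i, b i]) p.
Proof.
move=> hX cX mX.
have /choice[L Ll] : forall p : X, exists f : R -> X, line f /\ range f p.
  by move=> p; have [g lg gp] := mX p; exists g.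
have [||s [_ scov]] := @compact_finite_cover _ _ X setT (fun p => range (L p)) cX.
- by move=> p _; have [[_ _ Lop] _] := Ll p; exact/Lop/openT.
- by move=> p _; exists p => //; have [] := Ll p.
have /choice[C CP] : forall i : 'I_(size s), exists kab : (R -> X) * R * R,
    simple_loop kab.1.1 kab.1.2 kab.2 /\
    range (L (tnth (in_tuple s) i)) `<=` kab.1.1 @` `[kab.1.2, kab.2].
  move=> i; have [k [a [b H]]] := line_sub_loop hX cX mX (Ll (tnth (in_tuple s) i)).1.
  by exists (k, a, b).
exists (size s), (fun i => (C i).1.1), (fun i => (C i).1.2), (fun i => (C i).2).
split=> [i|p]; first by have [] := CP i.
have [q qs Lqp] := scov p I.
have /tnthP[i qi] : q \in in_tuple s by [].
by exists i; have [_] := CP i; apply; rewrite -qi.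
Qed.

(** * Charts and saturated sets *)

Lemma pair_continuous (X Y Z : topologicalType) (f : X -> Y) (g : X -> Z) (x : X) :
  {for x, continuous f} -> {for x, continuous g} ->
  {for x, continuous (fun z => (f z, g z))}.
Proof.
move=> fC gC A [[P Q] [/= fP gQ] PQA].
have : nbhs x (f @^-1` P `&` g @^-1` Q) by apply: filterI; [exact: fC|exact: gC].
by apply: filterS => z [Pz Qz]; exact: PQA.
Qed.

Section Charts.
Variables (R : realType) (W : topologicalType) (k l : nat).
Implicit Types d : fchart R W k l.

(** The domain and the image of a chart are open, so continuity relative to them is continuity at
    each of their points. *)
Lemma chart_inverse d : is_chart d -> exists g : 'rV[R]_k * 'rV[R]_l -> W,
  [/\ forall p, fdom d p -> g (fmap d p) = p,
      forall z, (fmap d @` fdom d) z -> fdom d (g z) /\ fmap d (g z) = z,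
      forall p, fdom d p -> {for p, continuous (fmap d)} &
      forall z, (fmap d @` fdom d) z -> {for z, continuous g}].
Proof.
move=> [od oi [g [_ gf fg fC gC]]]; exists g; split=> //.
- by move=> _ [p dp <-]; rewrite gf.
- by move=> p dp; move: fC; rewrite continuous_open_subspace//; apply; rewrite inE.
- by move=> z dz; move: gC; rewrite continuous_open_subspace//; apply; rewrite inE.
Qed.

Lemma chart_preimage_open d O : is_chart d -> open O ->
  open (fdom d `&` fmap d @^-1` O).
Proof.
move=> cd oO; have [g [_ _ fC _]] := chart_inverse cd; have [od _ _] := cd.
rewrite openE => p [dp Op]; apply: filterI; first exact: open_nbhs_nbhs.
by apply: fC => //; exact: open_nbhs_nbhs.
Qed.

Lemma chart_image_open d O : is_chart d -> open O -> O `<=` fdom d ->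
  open (fmap d @` O).
Proof.
move=> cd oO Od; have [g [gf fg _ gC]] := chart_inverse cd; have [_ oi _] := cd.
rewrite openE => _ [p Op <-].
have di : (fmap d @` fdom d) (fmap d p) by exists p => //; exact: Od.
have : nbhs (fmap d p) (fmap d @` fdom d `&` g @^-1` O).
  apply: filterI; first exact: open_nbhs_nbhs.
  by apply: gC => //; rewrite gf; [exact: open_nbhs_nbhs|exact: Od].
by apply: filterS => z [dz Oz]; exists (g z) => //; have [] := fg z dz.
Qed.

Lemma ball_segment n (z x y : 'rV[R]_n) (e t : R) : 0 <= t <= 1 ->
  ball z e x -> ball z e y -> ball z e (x + t *: (y - x)).
Proof.
move=> /andP[t0 t1]; rewrite -!ball_normE /= => zx zy.
have -> : z - (x + t *: (y - x)) = (1 - t) *: (z - x) + t *: (z - y).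
  by apply/rowP => j; rewrite !mxE; lra.
apply: le_lt_trans (ler_normD _ _) _; rewrite !normrZ (ger0_norm t0) ger0_norm ?subr_ge0//.
move: t1; rewrite le_eqVlt => /orP[/eqP ->|t1]; first by rewrite subrr mul0r add0r mul1r.
have : (1 - t) * `|z - x| < (1 - t) * e by rewrite ltr_pM2l// subr_gt0.
have : t * `|z - y| <= t * e by rewrite ler_wpM2l// ltW.
lra.
Qed.

(* A box around [p]: any two of its points [q], [r] at the same height lie on one
   plaque, and sliding horizontally onto the vertical through [q] moves [r] to
   [q]. *)
Lemma chart_box d (p : W) (N : set W) : is_chart d -> fdom d p -> nbhs p N ->
  exists U : set W, [/\ open U, U p, U `<=` fdom d `&` N &
    forall q r, U q -> U r -> (fmap d q).2 = (fmap d r).2 ->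
      plaque d q r /\ exists s : W -> W,
      [/\ s r = q, {for r, continuous s} &
          forall r', U r' -> U (s r') /\ (fmap d (s r')).2 = (fmap d r').2]].
Proof.
move=> cd dp pN; have [g [gf fg fC gC]] := chart_inverse cd; have [od oi _] := cd.
set B := fmap d @` fdom d in fg gC oi.
have Bp : B (fmap d p) by exists p.
have : nbhs (fmap d p) (B `&` g @^-1` N).
  by apply: filterI; [exact: open_nbhs_nbhs|apply: gC => //; rewrite gf].
move=> /nbhs_ballP[e /= e0 eB].
pose U := fdom d `&` fmap d @^-1` (ball (fmap d p) e).
have Ug z : ball (fmap d p) e z -> U (g z) /\ fmap d (g z) = z.
  move=> bz; have [Bz _] := eB _ bz; have [dz fz] := fg z Bz.
  by split=> //; split=> //=; rewrite fz.
exists U; split.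
- by apply: chart_preimage_open => //; exact: ball_open.
- by split=> //; exact: ballxx.
- by move=> q [dq bq]; split=> //; have [_ /=] := eB _ bq; rewrite gf.
move=> q r [dq bq] [dr br] yqr; split.
  (* The horizontal segment from [q] to [r] stays in the ball, since balls of a product are products
     of convex balls. It is connected and at constant height. *)
  pose x t := (fmap d q).1 + t *: ((fmap d r).1 - (fmap d q).1).
  pose P := (fun t => g (x t, (fmap d q).2)) @` `[0, 1].
  have bx t : `[0, 1]%classic t -> ball (fmap d p) e (x t, (fmap d q).2).
    rewrite /= in_itv/= => ti; have [bq1 bq2] := bq; have [br1 br2] := br.
    by split=> //; exact: ball_segment.
  have : P `<=` plaque d q.
    apply: connected_component_max.
    - exists 0; rewrite /= ?in_itv/= ?lexx ?ler01//.
      by rewrite /x scale0r addr0 -surjective_pairing gf.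
    - move=> _ [t /bx/Ug[[dg _] fgt] <-]; split=> //=; by rewrite fgt.
    apply: connected_continuous_connected; first exact: segment_connected.
    apply/subspace_continuousP => t ti; apply: cvg_within_filter.
    apply: (@continuous_comp _ _ _ (fun t => (x t, (fmap d q).2)) g); last first.
      by apply: gC; have [] := eB _ (bx t ti).
    apply: pair_continuous; last exact: cst_continuous.
    by apply: cvgD; [exact: cvg_cst|exact: scalel_continuous].
  apply; exists 1; rewrite /= ?in_itv/= ?lexx ?ler01//.
  by rewrite /x scale1r addrC subrK yqr -surjective_pairing gf.
have bs r' : U r' -> ball (fmap d p) e ((fmap d q).1, (fmap d r').2).
  by move=> [_ [_ br']]; have [bq1 _] := bq; split.
(* The slide keeps the height and replaces the horizontal coordinate by that of [q]. *)
exists (fun r' => g ((fmap d q).1, (fmap d r').2)); split.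
- by rewrite -yqr -surjective_pairing gf.
- apply: (@continuous_comp _ _ _ (fun r' => ((fmap d q).1, (fmap d r').2)) g).
    apply: pair_continuous; first exact: cst_continuous.
    apply: (@continuous_comp _ _ _ (fmap d) snd); first exact: fC.
    exact: cvg_snd.
  by apply: gC; rewrite -yqr -surjective_pairing; exists q.
by move=> r' Ur'; have [Us fs] := Ug _ (bs _ Ur'); split=> //; rewrite fs.
Qed.

End Charts.

(** * Interiors, closures and complements of saturated sets *)

Section Saturation.
Variables (R : realType) (W : topologicalType) (k l : nat).
Variables (I : Type) (c : I -> fchart R W k l).
Hypothesis foliated : foliated_atlas c.

Lemma atlas_hausdorff : hausdorff_space W.
Proof. by case: foliated. Qed.

Lemma atlas_chart i : is_chart (c i).
Proof. by case: foliated. Qed.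

Lemma atlas_cover p : exists i, fdom (c i) p.
Proof. by case: foliated. Qed.

Lemma atlas_compat i j : fcompat (c i) (c j).
Proof. by case: foliated. Qed.

Lemma same_leaf_plaque i p q : fdom (c i) p -> plaque (c i) p q -> same_leaf c p q.
Proof. by move=> ip; exact: sl_step (sl_refl _ _) ip. Qed.

Lemma same_leaf_trans p q r :
  same_leaf c p q -> same_leaf c q r -> same_leaf c p r.
Proof. by move=> pq; elim=> // u v i _ pu iu uv; exact: sl_step pu iu uv. Qed.

Lemma leaf_saturated p : saturated c (leaf c p).
Proof. by move=> q r; exact: same_leaf_trans. Qed.

(** A symmetric local condition: near every point, inside or outside [E], membership depends only on
    the height in the chart. *)
Definition locally_saturated (E : set W) : Prop :=
  forall i p, fdom (c i) p -> exists2 U : set W, nbhs p U &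
    forall q r, U q -> U r -> (fmap (c i) q).2 = (fmap (c i) r).2 -> E q -> E r.

(* [E] is relatively clopen in every plaque. *)
Lemma locally_saturated_saturated E : locally_saturated E -> saturated c E.
Proof.
move=> lE p q Ep; elim=> // u v i _ Eu iu uv.
set C := plaque (c i) u in uv.
have yC w : C w -> fdom (c i) w /\ (fmap (c i) w).2 = (fmap (c i) u).2.
  by move=> /connected_component_sub.
suff : C `&` E = C by move=> CE; move: uv; rewrite -CE => -[].
apply: (@component_connected _ (fdom (c i) `&` [set q | (fmap (c i) q).2 = (fmap (c i) u).2]) u).
- by exists u; split=> //; exact: connected_component_refl.
(* A point of [C] in [E] has a neighbourhood whose points in [C] all lie in [E], so this open set
   cuts out of [C] exactly its part in [E]. The closed set needed next is built likewise from the
   complement of [E]. *)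
- exists (~` C `|` E)°; first exact: open_interior.
  apply/seteqP; split=> w [Cw Ew]; split=> //; last by have [/(_ Cw)|] := interior_subset Ew.
  have [iw yw] := yC _ Cw; have [U Uw UE] := lE _ _ iw; have Uww := nbhs_singleton Uw.
  apply: filterS Uw => z Uz; have [Cz|nCz] := pselect (C z); [right|by left].
  by apply: (UE w z) => //; have [_ ->] := yC _ Cz.
- exists (~` (~` C `|` ~` E)°); first exact/open_closedC/open_interior.
  apply/seteqP; split=> w [Cw Ew]; split=> //.
    by move=> /interior_subset[].
  apply: contrapT => nEw; apply: Ew.
  have [iw yw] := yC _ Cw; have [U Uw UE] := lE _ _ iw; have Uww := nbhs_singleton Uw.
  apply: filterS Uw => z Uz; have [Cz|nCz] := pselect (C z); [right|by left].
  move=> Ez; apply: nEw; apply: (UE z w) => //.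
  by have [_ ->] := yC _ Cz.
Qed.

(** [same_leaf] is generated by directed steps. Inside a box, however, the plaque through either of
    two points of equal height contains the other. *)
Lemma saturatedC E : saturated c E -> saturated c (~` E).
Proof.
move=> sE; apply: locally_saturated_saturated => i p ip.
have [U [oU Up Ui Ubox]] := chart_box (atlas_chart i) ip (filterT : nbhs p setT).
exists U => [|q r Uq Ur yqr nEq Er].
  exact: open_nbhs_nbhs.
apply: nEq; apply: (sE r) => //.
have [+ _] := Ubox r q Ur Uq (esym yqr); apply: same_leaf_plaque.
by have [] := Ui _ Ur.
Qed.

(** If [q] is interior to [E], points near [r] slide into [E], and each lies on the plaque of the
    point it slides to. *)
Lemma interior_saturated E : saturated c E -> saturated c E°.
Proof.
move=> sE; apply: locally_saturated_saturated => i p ip.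
have [U [oU Up Ui Ubox]] := chart_box (atlas_chart i) ip (filterT : nbhs p setT).
exists U => [|q r Uq Ur yqr Eq].
  exact: open_nbhs_nbhs.
have [_ [s [sr sC sU]]] := Ubox q r Uq Ur yqr.
have : nbhs r (U `&` s @^-1` E).
  by apply: filterI; [exact: open_nbhs_nbhs|apply: sC; rewrite sr].
apply: filterS => r' [Ur' Esr']; apply: (sE (s r')) => //.
have [Usr' ysr'] := sU _ Ur'.
have [+ _] := Ubox _ _ Usr' Ur' ysr'; apply: same_leaf_plaque.
by have [] := Ui _ Usr'.
Qed.

Lemma closure_saturated E : saturated c E -> saturated c (closure E).
Proof.
move=> sE; rewrite -[closure E]setCK -interiorC.
exact/saturatedC/interior_saturated/saturatedC.
Qed.

Lemma leaf_connected p : connected (leaf c p).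
Proof.
suff -> : leaf c p = connected_component (leaf c p) p by exact: component_connected.
apply/seteqP; split; last exact: connected_component_sub.
move=> q pq; have := pq; rewrite /leaf /= in pq; elim: pq => [pp|u v i pu IH iu uv pv].
  exact: connected_component_refl.
apply: (connected_component_trans (IH pu)).
apply: connected_component_max uv.
- exact: connected_component_refl.
- by move=> w uw; apply: sl_step uw.
- exact: component_connected.
Qed.

End Saturation.

(** * Minimal solenoids *)

Section Minimality.
Variables (R : realType) (W : topologicalType) (k l : nat).
Variables (I : Type) (c : I -> fchart R W k l) (S : set W).
Hypothesis foliated : foliated_atlas c.
Hypothesis solS : solenoid c S.
Hypothesis minS : sol_minimal c S.

Lemma solenoid_closed : closed S.
Proof. by case: solS => cS _; apply: compact_closed cS; exact: atlas_hausdorff foliated. Qed.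

(** The part of [S] outside [E] is compact and saturated. Were it nonempty, it would be all of [S]
    by minimality, but [S] meets [E]. *)
Lemma minimal_relatively_open E : saturated c E ->
  (forall p, S p -> E p -> \forall r \near p, S r -> E r) ->
  S `&` E !=set0 -> S `<=` E.
Proof.
move=> sE oE [p0 [Sp0 Ep0]] p Sp; apply: contrapT => nEp.
have [cS sS] := solS.
(* Relative openness says that [E] is cut out of [S] by an open set of [W]; this interior is one. *)
have AE : S `&` ~` E = S `&` ~` (~` S `|` E)°.
  apply/seteqP; split=> q [Sq Eq]; split=> //.
    by move=> /interior_subset[].
  move=> {}Eq'; apply: Eq; apply: filterS (oE q Sq Eq') => r SE.
  by have [/SE|] := pselect (S r); [right|left].
have : S `&` ~` E = S.
  apply: minS; first by move=> q [].
  - by exists p.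
  - by rewrite AE; apply: compact_closedI => //; exact/open_closedC/open_interior.
  - move=> q r [Sq nEq] qr; split; first exact: sS qr.
    exact: (saturatedC foliated sE) qr.
by move=> SE; move: Sp0; rewrite -SE => -[].
Qed.

(** The closure of a leaf is connected, compact and saturated, so it is all of [S]. *)
Lemma minimal_connected : S !=set0 -> connected S.
Proof.
move=> [p Sp]; have [cS sS] := solS.
have lS : closure (leaf c p) `<=` S.
  rewrite closureEbigcap => q; apply; split; first exact: solenoid_closed.
  by move=> r; exact: sS.
suff <- : closure (leaf c p) = S by apply: connected_closure; exact: leaf_connected.
apply: minS => //.
- by exists p; apply: subset_closure; exact: sl_refl.
- by apply: subclosed_compact cS lS; exact: closed_closure.
- exact: (closure_saturated foliated (@leaf_saturated _ _ _ _ _ _ _)).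
Qed.

Lemma minimal_open : S° !=set0 -> open S.
Proof.
move=> [p Sp]; rewrite openE; apply: minimal_relatively_open.
- by apply: interior_saturated => //; case: solS.
- move=> q _ Sq; have : nbhs q S° by apply: open_nbhs_nbhs; split=> //; exact: open_interior.
  by apply: filterS.
- by exists p; split=> //; exact: interior_subset.
Qed.

(** Asking for constant height in every chart at [p] makes the notion independent of charts. One
    compatible chart is enough to check it, because heights in one chart are functions of heights in
    another. *)
Definition isolated_plaque (p : W) : Prop :=
  S p /\ forall i, fdom (c i) p ->
    \forall r \near p, S r -> (fmap (c i) r).2 = (fmap (c i) p).2.

Lemma isolated_plaque_chart (d : fchart R W k l) p : open (fdom d) ->
  (forall i, fcompat d (c i)) -> S p -> fdom d p ->
  (\forall r \near p, S r -> (fmap d r).2 = (fmap d p).2) -> isolated_plaque p.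
Proof.
move=> od dc Sp dp pd; split=> // i ip.
have [Y dY] := dc i; have [oi _ _] := atlas_chart foliated i.
have : nbhs p (fdom d `&` fdom (c i)) by apply: filterI; exact: open_nbhs_nbhs.
by apply: filterS2 pd => r yr [dr ir] /yr; rewrite !dY// => ->.
Qed.

(** Points of [S] near [r] slide, at constant height and within [S], to points near [q], where only
    the height of [q] occurs. *)
Lemma isolated_plaque_saturated : saturated c isolated_plaque.
Proof.
apply: locally_saturated_saturated => // i p ip.
have [U [oU Up Ui Ubox]] := chart_box (atlas_chart foliated i) ip (filterT : nbhs p setT).
exists U => [|q r Uq Ur yqr [Sq isoq]].
  exact: open_nbhs_nbhs.
have [[iq _] [ir _]] := (Ui _ Uq, Ui _ Ur).
have [_ sS] := solS; have [oi _ _] := atlas_chart foliated i.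
have [qr [s [sr sC sU]]] := Ubox q r Uq Ur yqr.
have Sr : S r by apply: sS Sq _; exact: same_leaf_plaque qr.
apply: (@isolated_plaque_chart (c i)) => //; first by move=> j; exact: atlas_compat.
have : nbhs r (U `&` s @^-1` (fun q' => S q' -> (fmap (c i) q').2 = (fmap (c i) q).2)).
  by apply: filterI; [exact: open_nbhs_nbhs|apply: sC; rewrite sr; exact: isoq].
apply: filterS => r' [Ur' yr'] Sr'; have [Usr' ysr'] := sU _ Ur'.
rewrite -ysr' -yqr; apply: yr'; apply: sS Sr' _.
have [+ _] := Ubox _ _ Ur' Usr' (esym ysr'); apply: same_leaf_plaque.
by have [] := Ui _ Ur'.
Qed.

Lemma minimal_isolated p : isolated_plaque p -> S `<=` isolated_plaque.
Proof.
move=> isop; apply: minimal_relatively_open.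
- exact: isolated_plaque_saturated.
- move=> q Sq [_ isoq]; have [i iq] := atlas_cover foliated q.
  have [oi _ _] := atlas_chart foliated i.
  have : nbhs q (fdom (c i) `&` (fun r => S r -> (fmap (c i) r).2 = (fmap (c i) q).2)).
    by apply: filterI; [exact: open_nbhs_nbhs|exact: isoq].
  rewrite nbhsE => -[N [oN Nq] Nsub].
  have : nbhs q N by exact: open_nbhs_nbhs.
  apply: filterS => r Nr Sr; have [ir yr] := Nsub _ Nr.
  apply: (@isolated_plaque_chart (c i)) => //; first by move=> j; exact: atlas_compat.
  have : nbhs r N by exact: open_nbhs_nbhs.
  by apply: filterS => r' /Nsub[_ yr'] /yr' ->; rewrite yr.
- by exists p; split=> //; case: isop.
Qed.

Lemma isolated_leaf p : S p -> S `<=` isolated_plaque -> S = leaf c p.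
Proof.
move=> Sp iso; have [_ sS] := solS; apply/seteqP; split; last by move=> q; exact: sS.
apply: minimal_relatively_open.
- exact: leaf_saturated.
- move=> q Sq pq; have [i iq] := atlas_cover foliated q.
  have [_ isoq] := iso _ Sq.
  have [U [oU Uq Ui Ubox]] := chart_box (atlas_chart foliated i) iq (isoq i iq).
  have : nbhs q U by exact: open_nbhs_nbhs.
  apply: filterS => r Ur Sr; have [_ yr] := Ui _ Ur.
  have [qr _] := Ubox q r Uq Ur (esym (yr Sr)).
  exact: same_leaf_trans pq (same_leaf_plaque iq qr).
- by exists p; split=> //; exact: sl_refl.
Qed.

(** In a small box, [S] is the horizontal slice at the height [y0] of [p], and the horizontal
    coordinate parametrizes it. *)
Lemma isolated_manifold : S `<=` isolated_plaque -> is_manifold R k S.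
Proof.
move=> iso p Sp; have [_ sS] := solS; have [i ip] := atlas_cover foliated p.
have [_ isop] := iso _ Sp; have ci := atlas_chart foliated i.
have [U [oU Up Ui Ubox]] := chart_box ci ip (isop i ip).
have [g [gf fg fC gC]] := chart_inverse ci.
have Udom : U `<=` fdom (c i) by move=> q /Ui[].
pose y0 := (fmap (c i) p).2.
pose f x := g (x, y0).
pose O := (fun x => (x, y0)) @^-1` (fmap (c i) @` U).
have fO x : O x -> U (f x) /\ fmap (c i) (f x) = (x, y0).
  by move=> [u Uu ux]; rewrite /f -ux gf ?ux//; exact: Udom.
have OU r : U r -> S r -> (fmap (c i) r) = ((fmap (c i) r).1, y0).
  by move=> Ur Sr; rewrite /y0; have [_ <-//] := Ui _ Ur; exact: surjective_pairing.
have xC : continuous (fun x : 'rV[R]_k => (x, y0)).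
  by move=> x; apply: (@pair_continuous _ _ _ id (fun=> y0)); [exact: cvg_id|exact: cst_continuous].
exists U, O, f; split=> //.
  by apply: open_comp; [move=> *; exact: xC|exact: chart_image_open].
exists (fun r => (fmap (c i) r).1); split.
- apply/seteqP; split=> [_ [x /fO[Ufx fx] <-]|r [Ur Sr]].
    split=> //; apply: sS Sp _; apply: (same_leaf_plaque ip).
    by have [] := Ubox p (f x) Up Ufx; rewrite ?fx.
  exists (fmap (c i) r).1; last by rewrite /f -OU// gf//; exact: Udom.
  by exists r => //; exact: OU.
- by move=> x /fO[_ ->].
- by move=> r [Ur Sr]; rewrite /f -OU// gf//; exact: Udom.
- apply: continuous_in_subspaceT => x; rewrite inE => -[u Uu ux].
  apply: (@continuous_comp _ _ _ (fun x => (x, y0)) g); first exact: xC.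
  by apply: gC; exists u => //; exact: Udom.
- apply: continuous_in_subspaceT => r; rewrite inE => -[Ur Sr].
  by apply: (@continuous_comp _ _ _ (fmap (c i)) fst); [exact/fC/Udom|exact: cvg_fst].
Qed.

End Minimality.

(** * Transversal dimension one: manifold charts and flow boxes of an open solenoid *)

Section CodimensionOne.
Variables (R : realType) (k : nat).

(** The transversal coordinate is stored first, at index [ord0]. *)
Definition split_rV (v : 'rV[R]_k.+1) : 'rV[R]_k * 'rV[R]_1 :=
  (\row_(j < k) v ord0 (lift ord0 j), \row_(j < 1) v ord0 ord0).

Definition join_rV (z : 'rV[R]_k * 'rV[R]_1) : 'rV[R]_k.+1 :=
  \row_(j < k.+1) oapp (z.1 ord0) (z.2 ord0 ord0) (unlift ord0 j).

Lemma join_rVK : cancel join_rV split_rV.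
Proof.
move=> [x y]; rewrite /split_rV; congr pair; apply/rowP => j.
  by rewrite !mxE liftK.
by rewrite !mxE unlift_none/= (ord1 j).
Qed.

Lemma split_rVK : cancel split_rV join_rV.
Proof.
by move=> v; apply/rowP => j; rewrite !mxE; case: unliftP => [j'|] -> /=; rewrite ?mxE.
Qed.

Lemma split_rV_continuous : continuous split_rV.
Proof.
move=> v; apply: pair_continuous.
  apply: (@rV_continuous _ _ _ _ (fun j (v : 'rV[R]_k.+1) => v ord0 (lift ord0 j))).
    by move=> z j; rewrite mxE.
  by move=> j; exact: coord_continuous.
apply: (@rV_continuous _ _ _ _ (fun j (v : 'rV[R]_k.+1) => v ord0 ord0)).
  by move=> z j; rewrite mxE.
by move=> j; exact: coord_continuous.
Qed.

Lemma join_rV_continuous : continuous join_rV.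
Proof.
move=> z; apply: (@rV_continuous _ _ _ _
    (fun j (z : 'rV[R]_k * 'rV[R]_1) => oapp (z.1 ord0) (z.2 ord0 ord0) (unlift ord0 j))).
  by move=> w j; rewrite mxE.
move=> j; case: (unlift ord0 j) => [j'|] /=.
  apply: (@continuous_comp _ _ _ fst (fun x : 'rV[R]_k => x ord0 j')).
    exact: cvg_fst.
  exact: coord_continuous.
apply: (@continuous_comp _ _ _ snd (fun x : 'rV[R]_1 => x ord0 ord0)).
  exact: cvg_snd.
exact: coord_continuous.
Qed.

Lemma disc_open n : open (@disc R n).
Proof.
have sC : continuous (@sqnorm R n).
  have qC j : continuous (fun x : 'rV[R]_n => x ord0 j ^+ 2).
    move=> x; apply: (@continuous_comp _ _ _ (fun x : 'rV[R]_n => x ord0 j) (@GRing.exp R ^~ 2)).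
      exact: coord_continuous.
    exact: exprn_continuous.
  rewrite /sqnorm; elim: (index_enum _) => [|j s IH] x.
    by under eq_fun do rewrite big_nil; exact: cst_continuous.
  have -> : (fun x : 'rV[R]_n => \sum_(i <- j :: s) x ord0 i ^+ 2) =
      (fun x => x ord0 j ^+ 2 + \sum_(i <- s) x ord0 i ^+ 2).
    by apply/funext => z; rewrite big_cons.
  exact: (continuousD (qC j x) (IH x)).
rewrite (_ : @disc R n = @sqnorm R n @^-1` [set r | r < 1]) //.
by apply: open_comp; [move=> *; exact: sC|exact: open_lt].
Qed.

Lemma disc_coord n (x : 'rV[R]_n) j : disc x -> `|x ord0 j| < 1.
Proof.
rewrite /disc /= /sqnorm => x1.
rewrite -(@ltr_pXn2r _ 2)// ?nnegrE// expr1n real_normK ?num_real//.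
apply: le_lt_trans x1; rewrite (bigD1 j)//= lerDl.
by apply: sumr_ge0 => i _; exact: sqr_ge0.
Qed.

Lemma disc0 n : disc (0 : 'rV[R]_n).
Proof. by rewrite /disc /= /sqnorm big1 // => j _; rewrite mxE expr0n. Qed.

Variables (W : topologicalType) (I : Type) (c : I -> fchart R W k 1) (S : set W).
Hypothesis foliated : foliated_atlas c.

Lemma open_manifold : open S -> is_manifold R k.+1 S.
Proof.
move=> oS p Sp; have [i ip] := atlas_cover foliated p.
have ci := atlas_chart foliated i; have [oi _ _] := ci.
have [g [gf fg fC gC]] := chart_inverse ci.
pose U := fdom (c i) `&` S; have oU : open U by exact: openI.
have Ui : U `<=` fdom (c i) by move=> q [].
pose O := split_rV @^-1` (fmap (c i) @` U).
exists U, O, (g \o split_rV); split=> //.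
  apply: open_comp; last exact: chart_image_open.
  by move=> *; exact: split_rV_continuous.
have -> : U `&` S = U by rewrite /U -setIA setIid.
exists (join_rV \o fmap (c i)); split.
- apply/seteqP; split=> [_ [v [u Uu uv] <-]|u Uu].
    by rewrite /= -uv gf//; exact: Ui.
  exists (join_rV (fmap (c i) u)); rewrite /= ?join_rVK ?gf//; last exact: Ui.
  by rewrite /O /= join_rVK; exists u.
- by move=> v [u Uu uv]; rewrite /= -uv gf; [rewrite uv split_rVK|exact: Ui].
- by move=> u Uu; rewrite /= join_rVK gf//; exact: Ui.
- apply: continuous_in_subspaceT => v; rewrite inE => -[u Uu uv].
  apply: continuous_comp; first exact: split_rV_continuous.
  by apply: gC; exists u => //; exact: Ui.
- apply: continuous_in_subspaceT => u; rewrite inE => Uu.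
  by apply: continuous_comp; [exact/fC/Ui|exact: join_rV_continuous].
Qed.

Lemma open_flow_box p : open S -> S p -> exists d K,
  [/\ fdom d p, flow_box c S d K & open K].
Proof.
move=> oS Sp; have [i ip] := atlas_cover foliated p.
have ci := atlas_chart foliated i; have [oi _ _] := ci.
have [g [gf fg fC gC]] := chart_inverse ci.
case fp: (fmap (c i) p) => [x0 y0].
have : nbhs (x0, y0) (fmap (c i) @` (fdom (c i) `&` S)).
  rewrite -fp; apply: open_nbhs_nbhs; split; last by exists p.
  by apply: chart_image_open => //; exact: openI.
move=> /nbhs_ballP[e /= e0 eS].
pose K : set 'rV[R]_1 := ball y0 e.
(* Horizontal normalization of the chart: [p] moves to the centre and the radius [e] becomes 1. The
   Euclidean disc lies in the unit ball of the sup norm, so [h'] maps the disc times [K] into the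
   ball filled by [S]. Heights do not change, hence compatibility is inherited. *)
pose h (z : 'rV[R]_k * 'rV[R]_1) := (e^-1 *: (z.1 - x0), z.2).
pose h' (z : 'rV[R]_k * 'rV[R]_1) := (x0 + e *: z.1, z.2).
have hK : cancel h h'.
  by move=> [x y]; rewrite /h /h' /= scalerA divff ?gt_eqF// scale1r addrC subrK.
have h'K : cancel h' h.
  by move=> [x y]; rewrite /h /h' /= addrAC subrr add0r scalerA mulVf ?gt_eqF// scale1r.
have hC : continuous h.
  move=> z; apply: (@pair_continuous _ _ _
    (fun z : 'rV[R]_k * 'rV[R]_1 => e^-1 *: (z.1 - x0)) snd); last exact: cvg_snd.
  apply: (@continuous_comp _ _ _ (fun z : 'rV[R]_k * 'rV[R]_1 => z.1 - x0)
    (fun x : 'rV[R]_k => e^-1 *: x)); last exact: scaler_continuous.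
  by apply: continuousB; [exact: cvg_fst|exact: cst_continuous].
have h'C : continuous h'.
  move=> z; apply: (@pair_continuous _ _ _
    (fun z : 'rV[R]_k * 'rV[R]_1 => x0 + e *: z.1) snd); last exact: cvg_snd.
  apply: continuousD; first exact: cst_continuous.
  by apply: (@continuous_comp _ _ _ fst (fun x : 'rV[R]_k => e *: x));
    [exact: cvg_fst|exact: scaler_continuous].
have oB : open (@disc R k `*` K).
  rewrite openE => -[x y] [/= dx Ky]; exists (@disc R k, K) => //=; split.
    by apply: open_nbhs_nbhs; split=> //; exact: disc_open.
  by apply: open_nbhs_nbhs; split=> //; exact: ball_open.
have BS z : (@disc R k `*` K) z -> exists2 q, (fdom (c i) `&` S) q & fmap (c i) q = h' z.
  move=> [dz Kz]; apply: eS; split=> //; split=> // i0 j.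
  rewrite ord1 /ball/= !mxE opprD addNKr normrN normrM (gtr0_norm e0).
  by rewrite -[ltRHS]mulr1 ltr_pM2l//; exact: disc_coord.
pose d : fchart R W k 1 := FChart
  (fdom (c i) `&` fmap (c i) @^-1` (h @^-1` (@disc R k `*` K))) (h \o fmap (c i)).
have dS : fdom d `<=` S.
  move=> q [iq /BS[q' [iq' Sq'] fq']].
  by rewrite -(gf q)// -[fmap _ q]hK -fq' gf.
have dim : fmap d @` fdom d = @disc R k `*` K.
  apply/seteqP; split=> [_ [q [_ Bq] <-]//|z Bz].
  have [q [iq Sq] fq] := BS z Bz.
  have hq : h (fmap (c i) q) = z by rewrite fq h'K.
  by exists q => //; split=> //; rewrite /preimage /mkset hq.
have cd : is_chart d.
  have od : open (fdom d).
    by apply: chart_preimage_open => //; apply: open_comp => // *; exact: hC.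
  split=> //; first by rewrite dim.
  exists (g \o h'); split=> //.
  - by move=> q [iq _] /=; rewrite hK gf.
  - by rewrite dim => z /BS[q [iq _] fq] /=; rewrite -fq gf// fq h'K.
  - apply: continuous_in_subspaceT => q; rewrite inE => -[iq _].
    by apply: continuous_comp; [exact: fC|exact: hC].
  - rewrite dim; apply: continuous_in_subspaceT => z; rewrite inE => /BS[q [iq _] fq].
    by apply: continuous_comp; [exact: h'C|apply: gC; exists q].
exists d, K; split.
- split=> //=; rewrite fp /h/= subrr scaler0; split; [exact: disc0|exact: ballxx].
- split; last by rewrite (_ : fdom d `&` S = fdom d)//; exact/setIidl.
  split=> // j; split.
    by have [Y cY] := atlas_compat foliated j i; exists Y => q jq [iq _]; exact: cY.
  by have [Y cY] := atlas_compat foliated i j; exists Y => q [iq _] jq; exact: cY.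
- exact: ball_open.
Qed.

End CodimensionOne.

(** * Transversals *)

Lemma set_type_hausdorff (W : topologicalType) (T : set W) :
  hausdorff_space W -> hausdorff_space T.
Proof.
move=> hW p q pq; apply: val_inj; apply: hW => A B Ap Bq.
have vC := @initial_continuous T W set_val.
have [z [Az Bz]] := pq (set_val @^-1` A) (set_val @^-1` B) (vC p _ Ap) (vC q _ Bq).
by exists (set_val z).
Qed.

Lemma set_type_compact (W : topologicalType) (T : set W) :
  compact T -> compact [set: T].
Proof.
move=> cT F FF _.
have GT : (set_val @ F) T.
  by apply: (@filterS _ F _ setT); [move=> z _; exact: set_valP|exact: filterT].
have [w [Tw clw]] := cT _ _ GT.
exists (exist _ w (mem_set Tw)); split=> // A B FA.
rewrite nbhsE => -[_ [[B' oB' <-] B'w] B'B].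
have [||_ [[z Az <-] B'z]] := clw (set_val @` A) B'.
- by apply: (@filterS _ F _ A) => // z Az; exists z.
- by apply: open_nbhs_nbhs.
- by exists z; split=> //; exact: B'B.
Qed.

Lemma set_type_continuous (X W : topologicalType) (T : set W) (f : X -> T) :
  continuous (set_val \o f) -> continuous f.
Proof. exact: continuous_comp_initial. Qed.

Lemma const_mx_continuous (R : realType) (n : nat) :
  continuous (fun r : R => const_mx r : 'rV[R]_n).
Proof.
move=> r; apply: (@rV_continuous _ _ _ _ (fun _ r => r)) => [z j|j]; first by rewrite mxE.
exact: cvg_id.
Qed.

Lemma rV1E (R : realType) (y : 'rV[R]_1) : y = const_mx (y ord0 ord0).
Proof. by apply/rowP => j; rewrite mxE (ord1 j). Qed.

Lemma ball_const_mx (R : realType) (y : 'rV[R]_1) (e r : R) : 0 < e ->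
  ball y e (const_mx r) <-> `|r - y ord0 ord0| < e.
Proof.
move=> e0; split=> [[_ /(_ ord0 ord0)]|H]; first by rewrite /ball/= mxE distrC.
by split=> // i j; rewrite !ord1 /ball/= mxE distrC.
Qed.

Lemma line_id (R : realType) : line (@id R).
Proof. by split=> // [x|O oO]; [exact: cvg_id|rewrite image_id]. Qed.

(** * Transversals of an open solenoid *)

Section OpenTransversal.
Variables (R : realType) (W : topologicalType) (k : nat).
Variables (I : Type) (c : I -> fchart R W k 1) (S T : set W).
Hypothesis traT : sol_transversal c S T.

Lemma transversal_chart p : T p -> exists (V : set W) d K,
  [/\ open V, V p, flow_box c S d K, fdom d p &
      V `&` T = [set q | (fdom d `&` S) q /\ (fmap d q).1 = 0]].
Proof.
move=> Tp; have [_ _ /(_ p Tp)[V [oV Vp [_ [d [K [fb dp VT]]]]]]] := traT.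
by exists V, d, K.
Qed.

(** Slicing over the centre of the disc exhibits [K] as a preimage under a continuous map, which
    gives its openness when [S] is open. *)
Lemma flow_box_section d (K : set 'rV[R]_1) : flow_box c S d K -> K = (fun y => (0, y)) @^-1`
  (fmap d @` (fdom d `&` S)).
Proof.
move=> [_ ->]; apply/seteqP; split=> [y Ky|y []//].
by split=> //; exact: disc0.
Qed.

Lemma flow_box_open d (K : set 'rV[R]_1) : open S -> flow_box c S d K -> open K.
Proof.
move=> oS fb; rewrite (flow_box_section fb); have [[cd _] _] := fb.
have [od _ _] := cd.
apply: open_comp; last by apply: chart_image_open => //; exact: openI.
move=> y _; apply: (@pair_continuous 'rV[R]_1 'rV[R]_k 'rV[R]_1 (fun=> 0) id); last exact: cvg_id.
exact: cst_continuous.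
Qed.

(** The section [K] is open, so around [p] the transversal contains the points at horizontal
    coordinate 0 over an interval of heights; [atan] stretches this interval to the real line. *)
Lemma open_transversal_line (p : T) : open S ->
  exists2 f : R -> T, line f & range f p.
Proof.
move=> oS; have Tp := set_valP p; set p0 := set_val p in Tp.
have [V [d [K [oV Vp fb dp VT]]]] := transversal_chart Tp.
have oK := flow_box_open oS fb.
have KE := flow_box_section fb.
have [[cd _] _] := fb; have [g [gf fg fC gC]] := chart_inverse cd.
have [[_ Sp] xp] : [set q | (fdom d `&` S) q /\ (fmap d q).1 = 0] p0 by rewrite -VT.
pose y0 := (fmap d p0).2; pose a := y0 ord0 ord0.
have fp : fmap d p0 = (0, y0) by rewrite [LHS]surjective_pairing xp.
have Ky0 : K y0 by rewrite KE /= -fp; exists p0.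
have : nbhs y0 K by exact: open_nbhs_nbhs.
move=> /nbhs_ballP[e /= e0 eK].
have pi0 := pi_gt0 R.
(* The factor for which [b * atan] takes its values in []-e, e[]. *)
pose b := e / pi * 2.
have b0 : 0 < b by rewrite mulr_gt0// divr_gt0.
pose h t := a + b * atan t.
have hC : continuous h.
  move=> t; apply: cvgD; first exact: cvg_cst.
  by apply: (@continuous_comp _ _ _ (@atan R) ( *%R b)); [exact: continuous_atan|exact: mulrl_continuous].
have hinj : injective h.
  by move=> s t /addrI /(mulfI (lt0r_neq0 b0)) /(can_inj (@atanK R)).
have hop : forall O, open O -> open (h @` O).
  apply: injective_continuous_open => // x; exists id; [exact: line_id|by exists x].
have he t : `|h t - a| < e.
  rewrite /h addrC addKr normrM (gtr0_norm b0).
  have : `|atan t| < pi / 2 by rewrite ltr_norml atan_gtNpi2 atan_ltpi2.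
  rewrite -(ltr_pM2l b0) => /lt_le_trans; apply.
  by rewrite /b mulrACA divfK ?gt_eqF// mulfV// mulr1.
have Kh t : K (const_mx (h t)) by apply: eK; exact/ball_const_mx.
pose psi t := g (0, const_mx (h t)).
have psiP t : [/\ fdom d (psi t), S (psi t) & fmap d (psi t) = (0, const_mx (h t))].
  by have := Kh t; rewrite KE => -[q [dq Sq] fq]; rewrite /psi -fq gf.
have psiVT t : (V `&` T) (psi t).
  by rewrite VT /=; have [? ? ->] := psiP t.
have psiC : continuous psi.
  move=> t; apply: (@continuous_comp R ('rV[R]_k * 'rV[R]_1)%type W (fun t => (0, const_mx (h t))) g); last first.
    by apply: gC; have [dpsi _ fpsi] := psiP t; exists (psi t).
  apply: (@pair_continuous R 'rV[R]_k 'rV[R]_1 (fun=> 0) (fun t => const_mx (h t))).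
    exact: cst_continuous.
  by apply: (@continuous_comp R R 'rV[R]_1 h (fun r => const_mx r)); [exact: hC|exact: const_mx_continuous].
have psiinj : injective psi.
  move=> s t E; apply: hinj; have [_ _] := psiP s; rewrite E; have [_ _ ->] := psiP t.
  by move=> /(congr1 (fun z : 'rV[R]_k * 'rV[R]_1 => z.2 ord0 ord0)); rewrite /= !mxE => ->.
have psiT t : T (psi t) by have [] := psiVT t.
pose f t : T := exist _ (psi t) (mem_set (psiT t)).
have psiE q t : (V `&` T) q -> (fmap d q).2 ord0 ord0 = h t -> q = psi t.
  rewrite VT => -[[dq Sq] xq] yq; rewrite -(gf q dq) [fmap d q]surjective_pairing xq.
  by rewrite (rV1E (fmap d q).2) yq.
exists f; last first.
  exists 0 => //; apply: val_inj; apply/esym/psiE => //.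
  by rewrite /h atan0 mulr0 addr0.
split.
- exact: set_type_continuous.
- by move=> s t /(congr1 set_val)/psiinj.
(* An open set of [W] whose trace on [T] is the image of [O]: near [p], points of [T] are determined
   by their heights. *)
move=> O oO; exists (V `&` (fdom d `&` fmap d @^-1` [set z : 'rV[R]_k * 'rV[R]_1 | (h @` O) (z.2 ord0 ord0)])).
  apply: openI => //; apply: chart_preimage_open => //.
  apply: (@open_comp _ _ (fun z : 'rV[R]_k * 'rV[R]_1 => z.2 ord0 ord0)); last exact: hop.
  move=> z _; apply: (@continuous_comp _ _ _ snd (fun x : 'rV[R]_1 => x ord0 ord0)).
    exact: cvg_snd.
  exact: coord_continuous.
apply/seteqP; split=> [q [Vq [dq [t Ot ht]]]|_ [t Ot <-]].
  exists t => //; apply: val_inj; apply/esym/psiE => //.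
  by split=> //; exact: set_valP.
have [dt _ ft] := psiP t; have [Vt _] := psiVT t.
by split=> //; split=> //=; rewrite ft; exists t => //; rewrite mxE.
Qed.

Lemma open_transversal_circles : hausdorff_space W -> open S ->
  finite_union_of_circles R T.
Proof.
move=> hW oS; have [cT _ _] := traT.
have [n [f [a [b [loop cov]]]]] := compact_one_manifold_loops
  (set_type_hausdorff hW) (set_type_compact cT) (fun p => open_transversal_line p oS).
exists n, (fun i => (set_val \o f i) @` `[a i, b i]); split.
  apply/seteqP; split=> [p Tp|_ [i _ [t _ <-]]]; last exact: set_valP.
  have [i [t ti ft]] := cov (exist _ p (mem_set Tp)).
  by exists i => //; exists t => //=; rewrite ft.
move=> i; apply: simple_loop_circle => //; have [fC ab fab finj] := loop i.
split=> //.
- move=> t; apply: continuous_comp; first exact: fC.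
  exact: initial_continuous.
- by rewrite /= fab.
- by move=> x y xi yi /val_inj; exact: finj.
Qed.

End OpenTransversal.

(** A circle inside [T] is connected, so it would be a single point; but [circ 0] and [circ pi]
    differ. *)
Lemma circles_not_totally_disconnected (R : realType) (W : topologicalType)
    (T : set W) :
  T !=set0 -> finite_union_of_circles R T -> ~ totally_disconnected T.
Proof.
move=> [p Tp] [n [C [TC Ccirc]]] tdT.
have [i _ Cp] : (\bigcup_(i in [set: 'I_n]) C i) p by rewrite -TC.
have [f [g [fC gf fg fcont gcont]]] := Ccirc i.
have Ccon : connected (C i).
  rewrite -fC; apply: connected_continuous_connected fcont.
  rewrite -circ_image; apply: connected_continuous_connected; first exact: segment_connected.
  by apply: continuous_subspaceT; exact: circ_continuous.
have Cp1 q : C i q -> q = p.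
  move=> Cq; have : connected_component T p q.
    by apply: connected_component_max Cq => //; rewrite TC => z Cz; exists i.
  by rewrite tdT.
have pi0 := pi_ge0 R.
have cc t : t \in `[0, pi *+ 2] -> circle (circ t : 'rV[R]_2).
  by move=> ti; rewrite -circ_image; exists t.
have c0 : circle (circ 0 : 'rV[R]_2) by apply: cc; rewrite in_itv/= mulr2n; lra.
have c1 : circle (circ pi : 'rV[R]_2) by apply: cc; rewrite in_itv/= mulr2n; lra.
have fp v : circle v -> f v = p by move=> cv; apply: Cp1; rewrite -fC; exists v.
have : circ 0 = circ pi :> 'rV[R]_2.
  exact: etrans (esym (gf _ c0)) (etrans (congr1 g (etrans (fp _ c0) (esym (fp _ c1)))) (gf _ c1)).
by move=> /circ_eqP[]; rewrite cos0 cospi; lra.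
Qed.

(** * Transversals of a solenoid with empty interior *)

Section ThinTransversal.
Variables (R : realType) (W : topologicalType) (k : nat).
Variables (I : Type) (c : I -> fchart R W k 1) (S T : set W).
Hypothesis foliated : foliated_atlas c.
Hypothesis solS : solenoid c S.
Hypothesis traT : sol_transversal c S T.

(** If [K] contained an interval, [S] would fill the open set of the chart lying over the disc times
    that interval. *)
Lemma flow_box_thin d (K : set 'rV[R]_1) (r e : R) : S° = set0 ->
  flow_box c S d K -> 0 < e -> exists2 r', `|r' - r| < e & ~ K (const_mx r').
Proof.
move=> S0 [[cd _] fb] e0; apply: contrapT => nK.
have KE r' : `|r' - r| < e -> K (const_mx r').
  by move=> r'e; apply: contrapT => nKr'; apply: nK; exists r'.
have [g [gf _ _ _]] := chart_inverse cd.
pose B := @disc R k `*` ball (const_mx r : 'rV[R]_1) e.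
have BK z : B z -> (@disc R k `*` K) z.
  move=> [dz]; rewrite [z.2]rV1E => /(ball_const_mx _ _ e0); rewrite mxE => ze; split=> //.
  by rewrite [z.2]rV1E; exact: KE.
have oB : open B.
  rewrite openE => -[x y] [/= dx By]; exists (@disc R k, ball (const_mx r : 'rV[R]_1) e) => //=; split.
    by apply: open_nbhs_nbhs; split=> //; exact: disc_open.
  by apply: open_nbhs_nbhs; split=> //; exact: ball_open.
have B0 : B (0, const_mx r) by split; [exact: disc0|exact: ballxx].
have [q [dq Sq] fq] : (fmap d @` (fdom d `&` S)) (0, const_mx r) by rewrite fb; exact: BK.
suff : S° q by rewrite S0.
have : nbhs q (fdom d `&` fmap d @^-1` B).
  by apply: open_nbhs_nbhs; split; [exact: chart_preimage_open|split=> //=; rewrite fq].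
apply: filterS => s [ds /BK]; rewrite -fb => -[s' [ds' Ss'] fs'].
by rewrite -(gf s ds) -fs' gf.
Qed.

(** [D] is the part of [T] near [p] between two heights [a] and [b] that [K] misses, one on each
    side of the height of [p]. The open and the closed interval cut out the same set, which is
    therefore both relatively open and compact. The function [u] is the height, shifted to be
    positive. *)
Lemma thin_clopen_nbhs p (N : set W) : S° = set0 -> T p -> nbhs p N ->
  exists (D O : set W) (u : W -> R),
  [/\ D p, D `<=` N, open O, D = T `&` O & compact D] /\
  [/\ forall q, D q -> {for q, continuous u}, forall q, D q -> 0 < u q &
      forall q r, D q -> D r -> u q = u r -> q = r].
Proof.
move=> S0 Tp pN; have [V [d [K [oV Vp fb dp VT]]]] := transversal_chart traT Tp.
have [[cd _] fbK] := fb; have [g [gf fg fC gC]] := chart_inverse cd.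
have [[_ Sp] xp] : [set q | (fdom d `&` S) q /\ (fmap d q).1 = 0] p by rewrite -VT.
pose y (q : W) := (fmap d q).2 ord0 ord0; pose a0 := y p.
have fmapE q : (fmap d q).1 = 0 -> fmap d q = (0, const_mx (y q)).
  by move=> xq; rewrite [LHS]surjective_pairing xq -rV1E.
have [od oB _] := cd; set B := fmap d @` fdom d in fg gC oB.
have : nbhs (0 : 'rV[R]_k, const_mx a0 : 'rV[R]_1) (B `&` g @^-1` N).
  rewrite -fmapE//; apply: filterI; first by apply: open_nbhs_nbhs; split=> //; exists p.
  by apply: gC; [exists p|rewrite gf].
move=> /nbhs_ballP[e' /= e'0 e'B].
(* The bound by 1 makes the shifted height [y q - a0 + 1] positive on [D]. *)
pose e := Num.min e' 1; have e0 : 0 < e by rewrite lt_min e'0 ltr01.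
have eB r : `|r - a0| < e -> B (0, const_mx r) /\ N (g (0, const_mx r)).
  move=> re; apply: e'B; split; first exact: ballxx.
  by apply/ball_const_mx => //; rewrite mxE; apply: lt_le_trans re _; rewrite ge_min lexx.
have e20 : 0 < e / 2 by rewrite divr_gt0.
have [a ae Ka] := flow_box_thin (a0 - e / 2) S0 fb e20.
have [b be Kb] := flow_box_thin (a0 + e / 2) S0 fb e20.
have aa0 : a0 - e < a < a0 by move: ae; rewrite ltr_norml; lra.
have ba0 : a0 < b < a0 + e by move: be; rewrite ltr_norml; lra.
have abe r : a <= r <= b -> `|r - a0| < e by rewrite ltr_norml; lra.
have yC q : fdom d q -> {for q, continuous y}.
  move=> dq; apply: (@continuous_comp _ _ _ (fmap d) (fun z : 'rV[R]_k * 'rV[R]_1 => z.2 ord0 ord0)); first exact: fC.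
  apply: (@continuous_comp _ _ _ snd (fun x : 'rV[R]_1 => x ord0 ord0)).
    exact: cvg_snd.
  exact: coord_continuous.
pose O := V `&` (fdom d `&` y @^-1` `]a, b[).
have DP q : (T `&` O) q -> [/\ fdom d q, S q, a < y q < b & q = g (0, const_mx (y q))].
  move=> [Tq [Vq [dq]]]; rewrite /= in_itv/= => yab.
  have [[_ Sq] xq] : [set q | (fdom d `&` S) q /\ (fmap d q).1 = 0] q by rewrite -VT.
  by split=> //; rewrite -fmapE// gf.
exists (T `&` O), O, (fun q => y q - a0 + 1); split; split=> //.
- by split=> //; split=> //; split=> //=; rewrite in_itv/= -/a0; lra.
- move=> q /DP[_ _ yab ->]; have [] := eB (y q) => //; apply: abe; lra.
- apply: openI => //; rewrite openE => q [dq yq]; apply: filterI; first exact: open_nbhs_nbhs.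
  by apply: (yC q dq); apply: open_nbhs_nbhs; split=> //; exact: interval_open.
(* Since no point of [S] sits over the heights [a] and [b], closing the interval adds nothing. *)
- have -> : T `&` O = (fun r => g (0, const_mx r)) @` `[a, b] `&` S.
    apply/seteqP; split=> [q /[dup] Dq /DP[dq Sq yab qE]|_ [[r rab <-]]].
      by split=> //; exists (y q) => //; rewrite /= in_itv/=; lra.
    move: rab; rewrite /= in_itv/= => rab; set q := g _ => Sq.
    have [dq fq] := fg _ (eB r (abe r rab)).1; rewrite -/q in dq fq.
    have [Vq Tq] : (V `&` T) q by rewrite VT /= fq.
    have [_ Kr] : (@disc R k `*` K) (0, const_mx r) by rewrite -fbK -fq; exists q.
    split=> //; split=> //; split=> //=; rewrite /y fq /= mxE in_itv/=.
    move: rab => /andP[ar rb]; rewrite !lt_neqAle ar rb !andbT; apply/andP; split; apply/eqP => E.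
      by apply: Ka; rewrite E.
    by apply: Kb; rewrite -E.
  apply: compact_closedI; last exact: solenoid_closed foliated solS.
  apply: continuous_compact; last exact: segment_compact.
  apply: continuous_in_subspaceT => r; rewrite inE /= in_itv/= => rab.
  apply: (@continuous_comp R ('rV[R]_k * 'rV[R]_1)%type W (fun r => (0, const_mx r)) g); last first.
    by apply: gC; have [] := eB r (abe r rab).
  apply: (@pair_continuous R 'rV[R]_k 'rV[R]_1 (fun=> 0) (fun r => const_mx r)).
    exact: cst_continuous.
  exact: const_mx_continuous.
- move=> q /DP[dq _ _ _]; apply: continuousD; last exact: cst_continuous.
  by apply: continuousB; [exact: yC|exact: cst_continuous].
- move=> q /DP[_ _ yab _].
  have : e <= 1 by rewrite ge_min lexx orbT.
  lra.
- move=> q r /DP[_ _ _ qE] /DP[_ _ _ rE] E.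
  have yqr : y q = y r by lra.
  by rewrite qE rE yqr.
Qed.

(** A relatively clopen neighbourhood of [p] avoiding [q] contains the whole component of [p]. *)
Lemma thin_totally_disconnected : S° = set0 -> totally_disconnected T.
Proof.
move=> S0 p Tp; apply/seteqP; split=> [q pq|_ ->]; last exact: connected_component_refl.
apply: contrapT => qp.
have : nbhs p (~` [set q]).
  apply: open_nbhs_nbhs; split; last by move=> /= E; apply: qp; rewrite E.
  apply/closed_openC/accessible_closed_set1/hausdorff_accessible.
  exact: atlas_hausdorff foliated.
move=> pN; have [D [G [u [[Dp DN oG DE cD] _]]]] := thin_clopen_nbhs S0 Tp pN.
have CT := @connected_component_sub _ T p.
have CD : connected_component T p `&` D = connected_component T p.
  apply: component_connected.
  - by exists p; split=> //; exact: connected_component_refl.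
  - by exists G => //; rewrite DE setIA (setIidl CT).
  - by exists D => //; apply: compact_closed cD; exact: atlas_hausdorff foliated.
by move: pq; rewrite -CD => -[_ /DN]; apply.
Qed.

(** A point of [S] near [p] moves horizontally, at constant height, to a point of [T] near [p]. This
    can only be [p], so the heights agree. *)
Lemma isolated_point_plaque p (N : set W) : T p -> nbhs p N ->
  T `&` N `<=` [set p] -> isolated_plaque c S p.
Proof.
move=> Tp pN TN; have [V [d [K [oV Vp fb dp VT]]]] := transversal_chart traT Tp.
have [[cd compat] fbK] := fb; have [g [gf fg fC gC]] := chart_inverse cd.
have [[_ Sp] xp] : [set q | (fdom d `&` S) q /\ (fmap d q).1 = 0] p by rewrite -VT.
have [od _ _] := cd.
apply: (@isolated_plaque_chart _ _ _ _ _ c S foliated d) => //.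
  by move=> i; have [] := compat i.
have fp : (0, (fmap d p).2) = fmap d p by rewrite -xp -surjective_pairing.
have sC : {for p, continuous (fun r => g (0, (fmap d r).2))}.
  apply: (@continuous_comp W ('rV[R]_k * 'rV[R]_1)%type W (fun r => (0, (fmap d r).2)) g); last first.
    by rewrite fp; apply: gC; exists p.
  apply: (@pair_continuous W 'rV[R]_k 'rV[R]_1 (fun=> 0) (fun r => (fmap d r).2)).
    exact: cst_continuous.
  by apply: (@continuous_comp _ _ _ (fmap d) snd); [exact: fC|exact: cvg_snd].
have : nbhs p (fdom d `&` (fun r => g (0, (fmap d r).2)) @^-1` N).
  by apply: filterI; [exact: open_nbhs_nbhs|apply: sC; rewrite fp gf].
apply: filterS => r [dr Nr] Sr.
have [_ Kr] : (@disc R k `*` K) (fmap d r) by rewrite -fbK; exists r.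
have [u [du Su] fu] : (fmap d @` (fdom d `&` S)) (0, (fmap d r).2).
  by rewrite fbK; split=> //; exact: disc0.
have [Vu Tu] : (V `&` T) u by rewrite VT /= fu.
have Nu : N u by rewrite -(gf u du) fu.
by rewrite -(TN u (conj Tu Nu)) fu.
Qed.

(** Points of [T] near [p] all have the height of [p], and in the flow box height alone determines a
    point of [T]. *)
Lemma isolated_plaque_point p : T p -> isolated_plaque c S p ->
  exists2 N : set W, open N /\ N p & T `&` N `<=` [set p].
Proof.
move=> Tp [Sp iso]; have [V [d [K [oV Vp fb dp VT]]]] := transversal_chart traT Tp.
have [[cd compat] _] := fb; have [g [gf fg fC gC]] := chart_inverse cd.
have [i ip] := atlas_cover foliated p; have [oi _ _] := atlas_chart foliated i.
have [[Y ciY] _] := compat i; have [od _ _] := cd.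
have [_ xp] : [set q | (fdom d `&` S) q /\ (fmap d q).1 = 0] p by rewrite -VT.
have : nbhs p (V `&` fdom (c i) `&` (fun r => S r -> (fmap (c i) r).2 = (fmap (c i) p).2)).
  by apply: filterI; [apply: filterI; exact: open_nbhs_nbhs|exact: iso].
rewrite nbhsE => -[N [oN Np] NE]; exists N => // q [Tq Nq].
have [[Vq iq] yq] := NE _ Nq.
have [[dq Sq] xq] : [set q | (fdom d `&` S) q /\ (fmap d q).1 = 0] q by rewrite -VT.
rewrite /= -(gf q dq) -[RHS](gf p dp); congr g.
rewrite [LHS]surjective_pairing [RHS]surjective_pairing xq xp; congr pair.
by rewrite (ciY q)// (ciY p)// yq.
Qed.

Lemma isolated_transversal_finite : T `<=` isolated_plaque c S -> finite_set T.
Proof.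
move=> iso; have [cT _ _] := traT.
have /choice[N NP] : forall p, exists N : set W, T p -> [/\ open N, N p & T `&` N `<=` [set p]].
  move=> p; have [Tp|nTp] := pselect (T p); last by exists set0.
  by have [N [oN Np] TN] := isolated_plaque_point Tp (iso _ Tp); exists N.
have [||s [sT scov]] := @compact_finite_cover _ T W T N cT.
- by move=> p /NP[].
- by move=> p Tp; exists p => //; have [] := NP _ Tp.
apply: (@sub_finite_set _ _ [set` s]); last exact: finite_seq.
move=> p Tp; have [q qs Nqp] := scov p Tp; rewrite /=.
by have [_ _ /(_ p (conj Tp Nqp)) ->] := NP _ (sT _ qs).
Qed.

(* [T] is cut into finitely many relatively clopen pieces, each of which embeds
   into the positive reals; extending these embeddings by zero gives coordinates
   that separate points. *)
Lemma thin_transversal_embedding : S° = set0 ->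
  exists (n : nat) (H : T -> 'rV[R]_n), continuous H /\ injective H.
Proof.
move=> S0; have [cT _ _] := traT.
have /choice[DOu DP] : forall p : T, exists DOu : set W * set W * (W -> R),
    let: (D, G, u) := DOu in
    [/\ D (set_val p), open G, D = T `&` G & compact D] /\
    [/\ forall q, D q -> {for q, continuous u}, forall q, D q -> 0 < u q &
      forall q r, D q -> D r -> u q = u r -> q = r].
  move=> p; have [D [G [u [[Dp _ oG DE cD] uP]]]] :=
    thin_clopen_nbhs S0 (set_valP p) filterT.
  by exists (D, G, u).
pose D p := (DOu p).1.1; pose O p := (DOu p).1.2; pose u p := (DOu p).2.
have {}DP p : [/\ D p (set_val p), open (O p), D p = T `&` O p & compact (D p)] /\
    [/\ forall q, D p q -> {for q, continuous (u p)}, forall q, D p q -> 0 < u p q &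
      forall q r, D p q -> D p r -> u p q = u p r -> q = r].
  by have := DP p; rewrite /D /O /u; case: (DOu p) => -[].
have vC := @initial_continuous T W set_val.
have [||s [_ scov]] := @compact_finite_cover T setT T setT (fun p => set_val @^-1` (O p)) (set_type_compact cT).
- by move=> p _; have [[_ oO _ _] _] := DP p; apply: open_comp => // *; exact: vC.
- by move=> p _; exists p => //; have [[Dp _ DE _] _] := DP p; move: Dp; rewrite DE => -[].
(* Extension by zero is continuous because the piece is both open and closed in [T]. As [u] is
   positive on the piece, the value 0 means lying outside it. *)
pose v (p q : T) : R := if pselect (D p (set_val q)) then u p (set_val q) else 0.
pose t := in_tuple s.
exists (size s), (fun q => \row_j v (tnth t j) q); split.
  move=> q; apply: (@rV_continuous _ _ _ _ (fun j => v (tnth t j))) => [z j|j]; first by rewrite mxE.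
  have [[_ oO DE cD] [uC _ _]] := DP (tnth t j); set p := tnth t j in oO DE cD uC *.
  have [Dq|nDq] := pselect (D p (set_val q)).
    have Oq : nbhs q (set_val @^-1` (O p)).
      by apply: vC; apply: open_nbhs_nbhs; split=> //; move: Dq; rewrite DE => -[].
    have uvC : {for q, continuous (u p \o set_val)}.
      by apply: continuous_comp; [exact: vC|exact: uC].
    move=> A vA; have : nbhs q ((u p \o set_val) @^-1` A).
      by apply: uvC; move: vA; rewrite /v; case: pselect.
    apply: filterS2 Oq => z Oz Az; rewrite /= /v; case: pselect => // -[].
    by rewrite DE; split=> //; exact: set_valP.
  have Oq : nbhs q (set_val @^-1` (~` D p)).
    apply: vC; apply: open_nbhs_nbhs; split=> //; apply: closed_openC.
    by apply: compact_closed cD; exact: atlas_hausdorff foliated.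
  move=> A vA; apply: filterS Oq => z nDz; rewrite /= /v; case: pselect => //= _.
  by move: (nbhs_singleton vA); rewrite /v; case: pselect.
move=> q r /rowP E; apply: val_inj.
have [p ps Oq] := scov q Logic.I.
have /tnthP[j pj] : p \in t by [].
have [[_ _ DE _] [_ u0 uinj]] := DP p.
have Dq : D p (set_val q) by rewrite DE; split=> //; exact: set_valP.
have := E j; rewrite !mxE -pj /v; case: pselect => //= _; case: pselect => /= [Dr|_ uq0].
  exact: uinj.
by have := u0 _ Dq; rewrite uq0 ltxx.
Qed.

End ThinTransversal.

Lemma cantor_embedded (R : realType) (X : topologicalType) (x0 : X) (n : nat)
    (H : X -> 'rV[R]_n) :
  compact [set: X] -> hausdorff_space X -> zero_dimensional X ->
  perfect_set [set: X] -> continuous H -> injective H ->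
  exists f : cantor_space -> X, [/\ continuous f, injective f & range f = setT].
Proof.
move=> cX hX zX pX HC Hinj.
pose Z : pseudoPMetricType R := HB.pack (initial_topology H)
  (isPointed.Build (initial_topology H) x0).
(* [Z] is [X] with the topology induced by [H], which makes it pseudometric as the characterization
   of the Cantor space demands. By compactness [H] is a closed map, so the two topologies
   coincide. *)
have openZ (A : set X) : open (A : set Z) <-> open A.
  split=> [[B oB <-]|oA]; first by apply: open_comp => // *; exact: HC.
  exists (~` (H @` (~` A))).
    apply: closed_openC; apply: (compact_closed (@norm_hausdorff R 'rV[R]_n)).
    apply: continuous_compact; first exact: continuous_subspaceT.
    by rewrite -[~` A]setTI; apply: compact_closedI => //; exact: open_closedC.
  apply/seteqP; split=> [x nx|x Ax [y nAy /Hinj yx]]; last by apply: nAy; rewrite yx.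
  by apply: contrapT => nAx; apply: nx; exists x.
have idC : continuous (id : X -> Z) by apply/continuousP => A /openZ.
have idC' : continuous (id : Z -> X) by apply/continuousP => A /openZ.
have cl : cantor_like Z.
  split.
  - by apply/perfectTP => x /openZ; move/perfectTP: pX; exact.
  - have := @continuous_compact X Z id setT (continuous_subspaceT idC) cX.
    by rewrite image_id.
  - move=> x y xy; apply: hX => A B Ax By.
    exact: xy (idC' x _ Ax) (idC' y _ By).
  - move=> x y /zX[U [[oU cU] Ux Uy]]; exists U; split=> //; split; first exact/openZ.
    by rewrite -[U]setCK; apply/open_closedC/openZ/closed_openC.
have [f [fC _]] := homeomorphism_cantor_like cl.
exists f; split.
- by move=> x; apply: (@continuous_comp _ Z X f id); [exact: fC|exact: idC'].
- by move=> x y; apply: (@inj _ _ setT f); rewrite inE.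
- by apply/seteqP; split=> // x _; have [z _ <-] := @surj _ _ setT setT f x I; exists z.
Qed.

Lemma thin_transversal_cantor (R : realType) (W : topologicalType) (k : nat)
    (I : Type) (c : I -> fchart R W k 1) (S T : set W) :
  foliated_atlas c -> solenoid c S -> sol_transversal c S T -> T !=set0 ->
  S° = set0 -> (forall p, T p -> ~ isolated_plaque c S p) -> cantor_set T.
Proof.
move=> fol sol tra [p0 Tp0] S0 niso; have [cT _ _] := tra.
have hW := atlas_hausdorff fol.
have vC := @initial_continuous T W set_val.
have zT : zero_dimensional T.
  move=> x y /eqP xy.
  have xN : nbhs (set_val x) (~` [set set_val y]).
    apply: open_nbhs_nbhs; split; last by move=> /val_inj.
    exact/closed_openC/accessible_closed_set1/hausdorff_accessible.
  have [D [G [u [[Dx DN oG DE cD] _]]]] := thin_clopen_nbhs fol sol tra S0 (set_valP x) xN.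
  exists (set_val @^-1` D); split=> //; last by move=> /DN; apply.
  split; last by apply: closed_comp; [move=> *; exact: vC|exact: compact_closed].
  exists G => //; apply/seteqP; split=> z; rewrite /preimage/= DE; last by case.
  by move=> Gz; split=> //; exact: set_valP.
have pT : perfect_set [set: T].
  apply/perfectTP => x [B oB Bx].
  have Bvx : B (set_val x) by have : [set x] x by []; rewrite -Bx.
  apply: (niso (set_val x)); first exact: set_valP.
  apply: (isolated_point_plaque fol tra (N := B)); first exact: set_valP.
    exact: open_nbhs_nbhs.
  move=> q [Tq Bq]; have : (set_val @^-1` B) (exist _ q (mem_set Tq) : T) by [].
  by rewrite Bx => /(congr1 set_val).
have [n [H [HC Hinj]]] := thin_transversal_embedding fol sol tra S0.
have [f [fC finj fT]] := @cantor_embedded _ T (exist _ p0 (mem_set Tp0)) _ _ (set_type_compact cT)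
  (set_type_hausdorff hW) zT pT HC Hinj.
(* Taken with [id], the comparison of quotients turns the continuous bijection onto the subspace [T]
   into a homeomorphism onto [T] as a subset of [W]. *)
have [||||h] := @same_fibers_homeo _ _ _ setT id (set_val \o f) cantor_space_hausdorff hW cantor_space_compact.
- by exists point.
- by move=> x; exact: cvg_id.
- by move=> x; apply: continuous_comp; [exact: fC|exact: vC].
- by move=> z w _ _; split=> [->//|/val_inj/finj].
rewrite image_id -image_comp fT => hh; exists h.
rewrite (_ : T = set_val @` [set: T])//.
apply/seteqP; split=> [q Tq|_ [x _ <-]]; last exact: set_valP.
by exists (exist _ q (mem_set Tq)).
Qed.

Theorem mainTheorem6 (R : realType) (W : topologicalType) (k : nat)
  (I : Type) (c : I -> fchart R W k 1) (S T : set W) :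
  foliated_atlas c -> solenoid c S -> sol_minimal c S ->
  sol_transversal c S T -> T !=set0 ->
  let P1 := [/\ finite_union_of_circles R T, connected S,
                is_manifold R (k.+1) S &
                forall p, S p -> exists d K,
                  [/\ fdom d p, flow_box c S d K & open K]] in
  let P2 := totally_disconnected T /\
              ((finite_set T /\ [/\ connected S, is_manifold R k S &
                                     exists p, S = leaf c p])
               \/ cantor_set T) in
  (P1 /\ ~ P2) \/ (~ P1 /\ P2).
Proof.
move=> fol sol min tra T0 P1 P2.
have [cT TS _] := tra.
have conS : connected S.
  by have [p Tp] := T0; apply: minimal_connected fol sol min _; exists p; exact: TS.
have [S0|/set0P/(minimal_open fol sol min) oS] := eqVneq S° set0; last first.
  have circles := open_transversal_circles tra (atlas_hausdorff fol) oS.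
  left; split; last by case=> /(circles_not_totally_disconnected T0 circles).
  split=> //; first exact: open_manifold fol oS.
  by move=> p Sp; exact: (open_flow_box fol).
have tdT := thin_totally_disconnected fol sol tra S0.
right; split; first by case=> /(circles_not_totally_disconnected T0).
split=> //.
have [[p [Tp isop]]|niso] := pselect (exists p, T p /\ isolated_plaque c S p).
  have iso := minimal_isolated fol sol min isop.
  left; split; first by apply: (isolated_transversal_finite fol tra); exact: subset_trans iso.
  split=> //; first exact: isolated_manifold fol sol iso.
  by exists p; apply: isolated_leaf => //; exact: TS.
right; apply: thin_transversal_cantor fol sol tra T0 S0 _ => p Tp isop.
by apply: niso; exists p.
Qed.
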